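(* Let $P(\bar g,R,R^\perp,h)=\sum_{l\in L}a_l\,C^l(\bar g,R,R^\perp,h)$ be a geometric scalar quantity for two-dimensional submanifolds of codimension one (i.e. $m=2$, $n=3$), made of a linear combination of complete contractions of the general form $$C^l(\bar g,R,R^\perp,h)=\operatorname{contr}\big(\bar g^{\alpha_1\beta_1}\otimes\cdots\otimes R_{i_1j_1k_1l_1}\otimes\cdots\otimes R^\perp_{i_rj_r\alpha_r\beta_r}\otimes\cdots\otimes h^\circ_{i_sj_s}\otimes\cdots\otimes Hg_{i_tj_t}\big),$$ and assume that $\int_{\mathcal M}P(\bar g,R,R^\perp,h)\,d\mu_g$ is a global conformal invariant for $2$-submanifolds in $3$-manifolds. Then there exist $a,b\in\mathbb R$ such that $$P(\bar g,R,R^\perp,h)=a\,K+b\,|h^\circ|^2 .$$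
   Context: Let $f:\mathcal M^m\hookrightarrow(\bar{\mathcal M}^n,\bar g)$ be a smooth immersion into a Riemannian manifold, $2\le m<n$, with induced metric $g$ and volume measure $d\mu_g$. Latin indices are tangential, Greek indices are ambient or normal. $\bar\nabla$ is the Levi-Civita connection of $\bar g$, and $\pi_N$ is the projection onto the normal bundle. Tensors: $R_{ijkl}$ is the Riemann curvature tensor of $(\mathcal M,g)$; $R^\perp_{ij\alpha\beta}$ is the curvature of the normal connection $\nabla^\perp=\pi_N\bar\nabla$ on the normal bundle, defined by $[\nabla^\perp_i,\nabla^\perp_j]X_\alpha=R^\perp_{ij\alpha\beta}X^\beta$; $h(X,Y)=\pi_N(\bar\nabla_XY)$ is the second fundamental form; $H=\frac1m g^{ij}h_{ij}$ is the mean curvature; $h^\circ_{ij}=h_{ij}-Hg_{ij}$ is the traceless second fundamental form; $|h^\circ|^2=g^{ik}g^{jl}h^\circ_{ij}h^\circ_{kl}$ (in codimension one $h,H$ are regarded as scalar-valued via a unit normal). For $m=2$, $K$ is the Gauss curvature of $(\mathcal M,g)$. Complete contraction: take a finite tensor product of copies of the listed tensors and pair off all indices, contracting each pair with the (inverse) metric $\bar g$ (with $g$ for tangential indices). A complete contraction is a formal expression given by its factors and its pairing pattern. A geometric scalar quantity is a finite real linear combination $P=\sum_{l\in L}a_lC^l$ of such complete contractions (no covariant derivatives of the tensors appear). It has weight $k\in\mathbb Z$ if, under the rescaling $\bar g\mapsto t^2\bar g$ with constant $t>0$, it gets multiplied by $t^k$. Global conformal invariant: for $P$ of weight $-m$ (each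 $C^l$ being of weight $-m$), $\int_{\mathcal M}P\,d\mu_g$ is a global conformal invariant for $m$-submanifolds in $n$-manifolds if for every Riemannian manifold $(\bar{\mathcal M}^n,\bar g)$, every compact orientable immersed $m$-dimensional submanifold $f(\mathcal M^m)\subset\bar{\mathcal M}^n$ and every $\phi\in C^\infty(\bar{\mathcal M})$, setting $\hat{\bar g}=e^{2\phi}\bar g$ and denoting by hats the quantities computed with respect to $\hat{\bar g}$, one has $$\int_{\mathcal M}P(\hat{\bar g},\hat R,\hat R^\perp,\hat h)\,d\mu_{\hat g}=\int_{\mathcal M}P(\bar g,R,R^\perp,h)\,d\mu_g .$$ *)

(* Defs.v *)
From HB Require Import structures.
From mathcomp Require Import all_boot all_order all_algebra.
From mathcomp Require Import all_classical all_reals all_analysis.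

Set Implicit Arguments.
Unset Strict Implicit.
Unset Printing Implicit Defensive.

Import Order.TTheory GRing.Theory Num.Theory.
Import numFieldNormedType.Exports.
Local Open Scope classical_set_scope.
Local Open Scope ring_scope.

Definition pderiv (R : realType) n (W : normedModType R) (i : 'I_n)
  (f : 'rV[R]_n -> W) (x : 'rV[R]_n) : W := 'D_(delta_mx 0 i) f x.

Fixpoint Ck_on (R : realType) n (W : normedModType R) (k : nat)
    (U : set 'rV[R]_n) (f : 'rV[R]_n -> W) : Prop :=
  (forall x, U x -> {for x, continuous f}) /\
  if k is k'.+1 then
    forall i : 'I_n, (forall x, U x -> derivable f x (delta_mx 0 i)) /\
                     Ck_on k' U (pderiv i f)
  else True.

Definition smooth_on (R : realType) n (W : normedModType R)
  (U : set 'rV[R]_n) (f : 'rV[R]_n -> W) : Prop := forall k, Ck_on k U f.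

(* Row [i] is the partial derivative of [F] along the i-th coordinate. *)
Definition jac (R : realType) m n (F : 'rV[R]_m -> 'rV[R]_n) (x : 'rV[R]_m) :
  'M[R]_(m, n) := \matrix_(i, a) pderiv i F x 0 a.

(* From here on, [G] denotes the coefficients of a metric on an open subset of
   R^n and [F : R^m -> R^n] an immersion read in coordinates. *)

Definition inner (R : realType) n (A : 'M[R]_n) (v w : 'rV[R]_n) : R :=
  \sum_a \sum_b A a b * v 0 a * w 0 b.

Definition pullback (R : realType) m n (G : 'rV[R]_n -> 'M[R]_n)
    (F : 'rV[R]_m -> 'rV[R]_n) (x : 'rV[R]_m) : 'M[R]_m :=
  \matrix_(i, j) inner (G (F x)) (pderiv i F x) (pderiv j F x).

(* Gamma^k_ij, the upper index coming first. *)
Definition christoffel (R : realType) n (G : 'rV[R]_n -> 'M[R]_n)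
    (k i j : 'I_n) (x : 'rV[R]_n) : R :=
  2^-1 * \sum_l invmx (G x) k l *
    (pderiv i (fun y => G y j l) x + pderiv j (fun y => G y i l) x
     - pderiv l (fun y => G y i j) x).

(* The l-th component of [nabla_i, nabla_j] d_k. *)
Definition riemann_up (R : realType) n (G : 'rV[R]_n -> 'M[R]_n)
    (l k i j : 'I_n) (x : 'rV[R]_n) : R :=
  pderiv i (christoffel G l j k) x - pderiv j (christoffel G l i k) x
  + \sum_p (christoffel G l i p x * christoffel G p j k x
            - christoffel G l j p x * christoffel G p i k x).

(* R_ijkl, with the sign convention [nabla_i, nabla_j] X_k = R_ijkl X^l. *)
Definition riemann (R : realType) n (G : 'rV[R]_n -> 'M[R]_n)
    (i j k l : 'I_n) (x : 'rV[R]_n) : R :=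
  \sum_p G x k p * riemann_up G p l i j x.

Definition gauss_curvature (R : realType) (g : 'rV[R]_2 -> 'M[R]_2)
    (x : 'rV[R]_2) : R :=
  riemann g ord0 ord_max ord0 ord_max x / \det (g x).

(* The ambient covariant derivative, in the direction of the i-th coordinate of
   the submanifold, of a vector field [X] along [F]. *)
Definition cov_deriv (R : realType) m n (G : 'rV[R]_n -> 'M[R]_n)
    (F : 'rV[R]_m -> 'rV[R]_n) (i : 'I_m) (X : 'rV[R]_m -> 'rV[R]_n)
    (x : 'rV[R]_m) : 'rV[R]_n :=
  \row_a (pderiv i X x 0 a
          + \sum_b \sum_c christoffel G a b c (F x) * pderiv i F x 0 b * X x 0 c).

Definition normal_proj (R : realType) m n (G : 'rV[R]_n -> 'M[R]_n)
    (F : 'rV[R]_m -> 'rV[R]_n) (x : 'rV[R]_m) (v : 'rV[R]_n) : 'rV[R]_n :=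
  v - \sum_k \sum_l (invmx (pullback G F x) k l * inner (G (F x)) v (pderiv k F x))
                    *: pderiv l F x.

Definition normal_deriv (R : realType) m n (G : 'rV[R]_n -> 'M[R]_n)
    (F : 'rV[R]_m -> 'rV[R]_n) (i : 'I_m) (X : 'rV[R]_m -> 'rV[R]_n)
    (x : 'rV[R]_m) : 'rV[R]_n :=
  normal_proj G F x (cov_deriv G F i X x).

Definition second_form (R : realType) m n (G : 'rV[R]_n -> 'M[R]_n)
    (F : 'rV[R]_m -> 'rV[R]_n) (i j : 'I_m) (x : 'rV[R]_m) : 'rV[R]_n :=
  normal_proj G F x (cov_deriv G F i (pderiv j F) x).

(* The Euclidean cross product of d_1 F and d_2 F; as a covector it annihilates
   the tangent plane, whatever the metric.  It fixes the sign of the unit normal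
   below in a pair of charts.  Changing that sign does not affect contractions
   with an even number of factors built from h, in particular those of weight -2
   that do not vanish identically. *)
Definition conormal (R : realType) (F : 'rV[R]_2 -> 'rV[R]_3) (x : 'rV[R]_2) :
  'rV[R]_3 := \row_a \det (col_mx (delta_mx 0 a : 'rV[R]_3) (jac F x) : 'M[R]_3).

Definition unit_normal (R : realType) (G : 'rV[R]_3 -> 'M[R]_3)
    (F : 'rV[R]_2 -> 'rV[R]_3) (x : 'rV[R]_2) : 'rV[R]_3 :=
  let v := conormal F x *m invmx (G (F x)) in
  (Num.sqrt (inner (G (F x)) v v))^-1 *: v.

Definition scalar_h (R : realType) (G : 'rV[R]_3 -> 'M[R]_3)
    (F : 'rV[R]_2 -> 'rV[R]_3) (i j : 'I_2) (x : 'rV[R]_2) : R :=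
  inner (G (F x)) (second_form G F i j x) (unit_normal G F x).

Definition mean_curvature (R : realType) (G : 'rV[R]_3 -> 'M[R]_3)
    (F : 'rV[R]_2 -> 'rV[R]_3) (x : 'rV[R]_2) : R :=
  2^-1 * \sum_i \sum_j invmx (pullback G F x) i j * scalar_h G F i j x.

Definition traceless_h (R : realType) (G : 'rV[R]_3 -> 'M[R]_3)
    (F : 'rV[R]_2 -> 'rV[R]_3) (i j : 'I_2) (x : 'rV[R]_2) : R :=
  scalar_h G F i j x - mean_curvature G F x * pullback G F x i j.

Definition traceless_h_sqnorm (R : realType) (G : 'rV[R]_3 -> 'M[R]_3)
    (F : 'rV[R]_2 -> 'rV[R]_3) (x : 'rV[R]_2) : R :=
  let gi := invmx (pullback G F x) in
  \sum_i \sum_j \sum_k \sum_l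
    gi i k * gi j l * traceless_h G F i j x * traceless_h G F k l x.

(* R^perp_ij(alpha)(beta).  The normal bundle is spanned by the unit normal nu,
   so [nabla^perp_i, nabla^perp_j] X_alpha = R^perp_ij(alpha)(beta) X^beta
   amounts to R^perp_ij(alpha)(beta) = W_alpha nu_beta, where
   W = [nabla^perp_i, nabla^perp_j] nu. *)
Definition normal_curvature (R : realType) (G : 'rV[R]_3 -> 'M[R]_3)
    (F : 'rV[R]_2 -> 'rV[R]_3) (i j : 'I_2) (a b : 'I_3) (x : 'rV[R]_2) : R :=
  let nu := unit_normal G F in
  let W := normal_deriv G F i (normal_deriv G F j nu) x
           - normal_deriv G F j (normal_deriv G F i nu) x in
  (W *m G (F x)) 0 a * (nu x *m G (F x)) 0 b.

(* A factor carries index slots: tangential slots in [I], ambient ones in [J]. *)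

Inductive factor (I J : Type) : Type :=
| Riem (i j k l : I)
| NormalCurv (i j : I) (a b : J)
| TracelessH (i j : I)
| MeanCurvMetric (i j : I).

Definition tangential_slots I J (T : factor I J) : seq I :=
  match T with
  | Riem i j k l => [:: i; j; k; l]
  | NormalCurv i j _ _ => [:: i; j]
  | TracelessH i j => [:: i; j]
  | MeanCurvMetric i j => [:: i; j]
  end.

Definition ambient_slots I J (T : factor I J) : seq J :=
  match T with
  | NormalCurv _ _ a b => [:: a; b]
  | _ => [::]
  end.

(* [(p, false)] and [(p, true)] are the two ends of the p-th contracted pair:
   each of them must occur exactly once among the slots of the factors. *)
Record complete_contraction : Type := CompleteContraction {
  tpairs : nat;
  apairs : nat;
  factors : seq (factor ('I_tpairs * bool) ('I_apairs * bool));
  tangential_slotsP :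
    perm_eq (flatten [seq tangential_slots T | T <- factors])
            (enum {: 'I_tpairs * bool});
  ambient_slotsP :
    perm_eq (flatten [seq ambient_slots T | T <- factors])
            (enum {: 'I_apairs * bool})
}.

Definition factor_component (R : realType) (G : 'rV[R]_3 -> 'M[R]_3)
    (F : 'rV[R]_2 -> 'rV[R]_3) (x : 'rV[R]_2) I J (s : I -> 'I_2) (t : J -> 'I_3)
    (T : factor I J) : R :=
  match T with
  | Riem i j k l => riemann (pullback G F) (s i) (s j) (s k) (s l) x
  | NormalCurv i j a b => normal_curvature G F (s i) (s j) (t a) (t b) x
  | TracelessH i j => traceless_h G F (s i) (s j) x
  | MeanCurvMetric i j => mean_curvature G F x * pullback G F x (s i) (s j)
  end.

Definition contraction_value (R : realType) (C : complete_contraction)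
    (G : 'rV[R]_3 -> 'M[R]_3) (F : 'rV[R]_2 -> 'rV[R]_3) (x : 'rV[R]_2) : R :=
  \sum_(s : {ffun 'I_(tpairs C) * bool -> 'I_2})
  \sum_(t : {ffun 'I_(apairs C) * bool -> 'I_3})
    (\prod_(p < tpairs C) invmx (pullback G F x) (s (p, false)) (s (p, true)))
    * (\prod_(q < apairs C) invmx (G (F x)) (t (q, false)) (t (q, true)))
    * \prod_(T <- factors C) factor_component G F x s t T.

Definition geometric_scalar (R : realType) : Type := seq (R * complete_contraction).

Definition scalar_value (R : realType) (P : geometric_scalar R)
    (G : 'rV[R]_3 -> 'M[R]_3) (F : 'rV[R]_2 -> 'rV[R]_3) (x : 'rV[R]_2) : R :=
  \sum_(aC <- P) aC.1 * contraction_value aC.2 G F x.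

Record chart (R : realType) (n : nat) (M : topologicalType) : Type := Chart {
  cdom : set M;
  cmap : M -> 'rV[R]_n;
  cinv : 'rV[R]_n -> M;
  cdom_open : open cdom;
  cimage_open : open (cmap @` cdom);
  cmapK : forall p, cdom p -> cinv (cmap p) = p;
  cmap_continuous : forall p, cdom p -> {for p, continuous cmap};
  cinv_continuous : forall x, (cmap @` cdom) x -> {for x, continuous cinv}
}.

(* Source and coordinate expression of the change of charts from [c] to [c']. *)
Definition overlap (R : realType) n (M : topologicalType) (c c' : chart R n M) :
  set 'rV[R]_n := cmap c @` (cdom c `&` cdom c').

Definition transition (R : realType) n (M : topologicalType)
  (c c' : chart R n M) : 'rV[R]_n -> 'rV[R]_n := fun x => cmap c' (cinv c x).

Definition smooth_atlas (R : realType) n (M : topologicalType)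
    (A : set (chart R n M)) : Prop :=
  (forall p : M, exists2 c, A c & cdom c p) /\
  (forall c c', A c -> A c' -> smooth_on (overlap c c') (transition c c')).

Record manifold (R : realType) (n : nat) : Type := Manifold {
  carrier :> topologicalType;
  atlas : set (chart R n carrier);
  carrier_hausdorff : hausdorff_space carrier;
  carrier_second_countable : @second_countable carrier;
  atlasP : smooth_atlas atlas
}.

Definition orientable (R : realType) n (M : manifold R n) : Prop :=
  exists B : set (chart R n M),
    [/\ smooth_atlas B, smooth_atlas (atlas (m := M) `|` B) &
        forall c c', B c -> B c' ->
          forall x, overlap c c' x -> 0 < \det (jac (transition c c') x)].

Definition smooth_function (R : realType) n (M : manifold R n) (u : M -> R) :
    Prop :=
  forall c, atlas c -> smooth_on (cmap c @` cdom c) (fun x => u (cinv c x)).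

(* The coefficients of a metric in each chart; only the values at charts of the
   atlas, on the image of the chart, are meaningful. *)
Definition metric (R : realType) n (M : manifold R n) : Type :=
  chart R n M -> 'rV[R]_n -> 'M[R]_n.

Definition riemannian (R : realType) n (M : manifold R n) (G : metric M) :
    Prop :=
  [/\ forall c i j, atlas c ->
        smooth_on (cmap c @` cdom c) (fun x => G c x i j),
      forall c x i j, atlas c -> (cmap c @` cdom c) x -> G c x i j = G c x j i,
      forall c x v, atlas c -> (cmap c @` cdom c) x -> v != 0 ->
        0 < inner (G c x) v v &
      forall c c' x, atlas c -> atlas c' -> overlap c c' x ->
        G c x = pullback (G c') (transition c c') x].

Definition rescale (R : realType) n (M : manifold R n) (t : R) (G : metric M) :
  metric M := fun c x => t ^+ 2 *: G c x.

Definition conformal (R : realType) n (M : manifold R n) (u : M -> R)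
    (G : metric M) : metric M :=
  fun c x => expR (2 * u (cinv c x)) *: G c x.

Definition local_rep (R : realType) m n (M : manifold R m) (N : manifold R n)
    (f : M -> N) (c : chart R m M) (c' : chart R n N) :
  'rV[R]_m -> 'rV[R]_n := fun x => cmap c' (f (cinv c x)).

Definition immersion (R : realType) m n (M : manifold R m) (N : manifold R n)
    (f : M -> N) : Prop :=
  continuous f /\
  forall c c', atlas c -> atlas c' ->
    let U := cmap c @` (cdom c `&` f @^-1` cdom c') in
    smooth_on U (local_rep f c c') /\
    forall x, U x -> row_free (jac (local_rep f c c') x).

Definition chart_pair (R : realType) (M : manifold R 2) (N : manifold R 3)
    (f : M -> N) (p : M) (c : chart R 2 M) (c' : chart R 3 N) : Prop :=
  [/\ atlas c, atlas c', cdom c p & cdom c' (f p)].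

Definition has_weight (R : realType) (C : complete_contraction) (k : int) : Prop :=
  forall (M : manifold R 2) (N : manifold R 3) (G : metric N) (f : M -> N),
    riemannian G -> immersion f ->
    forall p c c', chart_pair f p c c' -> forall t : R, 0 < t ->
      contraction_value C (rescale t G c') (local_rep f c c') (cmap c p)
      = t ^ k * contraction_value C (G c') (local_rep f c c') (cmap c p).

Definition plane_point (R : realType) (z : R * R) : 'rV[R]_2 :=
  \row_i (if i == 0 then z.1 else z.2).

Definition chart_patch (R : realType) (M : manifold R 2) (N : manifold R 3)
    (f : M -> N) (cc : chart R 2 M * chart R 3 N) : set M :=
  cdom cc.1 `&` f @^-1` cdom cc.2.

Definition patch_cover (R : realType) (M : manifold R 2) (N : manifold R 3)
    (f : M -> N) k (cc : 'I_k -> chart R 2 M * chart R 3 N) : Prop :=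
  (forall i, atlas (cc i).1 /\ atlas (cc i).2) /\
  (forall p, exists i, chart_patch f (cc i) p).

(* The integral of P over M with respect to the Riemannian measure of the
   induced metric.  M is cut into the disjoint pieces consisting of the points
   of the i-th patch lying in no earlier patch, and on each of them P sqrt(det g)
   is integrated in coordinates. *)
Definition surface_integral (R : realType) (M : manifold R 2) (N : manifold R 3)
    (f : M -> N) k (cc : 'I_k -> chart R 2 M * chart R 3 N)
    (G : metric N) (P : geometric_scalar R) : R :=
  \sum_(i < k)
    let c := (cc i).1 in
    let c' := (cc i).2 in
    let F := local_rep f c c' in
    let piece :=
      chart_patch f (cc i) `\` \bigcup_(j in [set j : 'I_k | (j < i)%N]) chart_patch f (cc j) in
    \int[(@lebesgue_measure R \x @lebesgue_measure R)%E]_(z in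
          [set z | (cmap c @` piece) (plane_point z)])
      (scalar_value P (G c') F (plane_point z)
       * Num.sqrt (\det (pullback (G c') F (plane_point z)))).

Definition global_conformal_invariant (R : realType) (P : geometric_scalar R) :
    Prop :=
  (forall l aC, onth P l = Some aC -> has_weight R aC.2 (-2)) /\
  (forall (M : manifold R 2) (N : manifold R 3) (G : metric N) (f : M -> N)
          (phi : N -> R),
     compact [set: M] -> orientable M -> riemannian G -> immersion f ->
     smooth_function phi ->
     forall k (cc : 'I_k -> chart R 2 M * chart R 3 N), patch_cover f cc ->
       surface_integral f cc (conformal phi G) P = surface_integral f cc G P).

(* Main.v *)
Require Import Defs.
From HB Require Import structures.
From mathcomp Require Import all_boot all_order all_algebra.
From mathcomp Require Import all_classical all_reals all_analysis.
From mathcomp Require Import ring lra.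
Set Implicit Arguments.
Unset Strict Implicit.
Unset Printing Implicit Defensive.
Import Order.TTheory GRing.Theory Num.Theory.
Import numFieldNormedType.Exports.
Local Open Scope classical_set_scope.
Local Open Scope ring_scope.

(* Under g -> t^2 g every contraction is homogeneous, of degree minus the number
   of factors, curvatures counting twice; hence one of weight -2 either vanishes
   identically or has a single curvature factor or two factors built from h.
   The pairings of the indices then leave only K, |h0|^2 and H^2, so that
   P = a K + b |h0|^2 + c H^2 with universal constants.  To see that c = 0, take
   the flat torus R^2/Z^2 x {0} inside R^2/Z^2 x R and the conformal factor
   exp(2 z): on the torus it changes neither the induced metric nor K = h0 = 0,
   but it replaces H = 0 by H = -1, so that the integral of P moves from 0 to c. *)

(** * Partial derivatives *)

(** The coefficients a, b, c have to be the same for all geometries, so whatever depends only on the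
    index pattern of a contraction is settled before the metric and the immersion are introduced.
    Identifying the contractions of the curvature needs its antisymmetry in the last two indices,
    which has to be derived from the coordinate definition; this rests on the equality of mixed
    partial derivatives and explains the calculus below. The test surface is chosen so that all
    integrands are constant. Under a conformal change exp(2 phi) the mean curvature is shifted by
    the normal derivative of phi, while the induced metric sees only phi on the surface; phi = z
    vanishes on the torus but has normal derivative 1. Since z is not periodic, the quotient is
    taken in two directions only: compactness is asked of the surface alone. *)

Section directional_derivatives.
Variable R : realType.

(* No differentiability of [f] is needed: the limit of a divergent difference
   quotient is [point], here 0, which scales as well. *)
Lemma derive_scale (V W : normedModType R) (c : R) (f : V -> W) (a v : V) :
  (point : W) = 0 -> c != 0 -> 'D_v (fun y => c *: f y) a = c *: 'D_v f a.
Proof.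
move=> W0 c0.
have [df|ndf] := pselect (derivable f a v); first by rewrite (deriveZ c df).
have ndf' : ~ derivable (fun y => c *: f y) a v.
  move=> df; apply: ndf; move: (@derivableZ _ _ _ _ c^-1 _ _ df).
  suff -> : c^-1 \*: (fun y => c *: f y) = f by [].
  by apply/funext => y /=; rewrite scalerA mulVf// scale1r.
have d0 (g : V -> W) : ~ derivable g a v -> 'D_v g a = 0.
  by move=> /dvgP; rewrite /derive => ->.
by rewrite (d0 _ ndf) (d0 _ ndf') scaler0.
Qed.

(** The difference quotients agree as functions of [h], before any limit is taken, so derivability
    and the value of the derivative on the line are both transferred by rewriting. *)
Lemma growth_line (V W : normedModType R) (f : V -> W) (y v : V) (t : R) :
  (fun h => h^-1 *: (((fun s : R => f (y + s *: v)) \o shift t) (h *: (1 : R))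
     - f (y + t *: v))) =
  (fun h => h^-1 *: ((f \o shift (y + t *: v)) (h *: v) - f (y + t *: v))).
Proof.
apply/funext => h /=; congr (_ *: (f _ - _)).
by rewrite [h%:A]mulr1 scalerDl addrCA.
Qed.

Lemma is_derive_line (V W : normedModType R) (f : V -> W) (y v : V) (t : R) :
  derivable f (y + t *: v) v ->
  is_derive t 1 (fun s : R => f (y + s *: v)) ('D_v f (y + t *: v)).
Proof. by move=> df; split; rewrite /derivable/derive growth_line. Qed.

Lemma growth_shift (V W : normedModType R) (f : V -> W) (y v w : V) :
  (fun h : R => h^-1 *: (((fun z => f (z + w)) \o shift y) (h *: v) - f (y + w))) =
  (fun h => h^-1 *: ((f \o shift (y + w)) (h *: v) - f (y + w))).
Proof. by apply/funext => h /=; rewrite addrA. Qed.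

Lemma derive_shiftE (V W : normedModType R) (f : V -> W) (y v w : V) :
  'D_v (fun z => f (z + w)) y = 'D_v f (y + w).
Proof. by rewrite /derive growth_shift. Qed.

Lemma derivable_shift (V W : normedModType R) (f : V -> W) (y v w : V) :
  derivable f (y + w) v -> derivable (fun z => f (z + w)) y v.
Proof. by rewrite /derivable growth_shift. Qed.

(** The one-variable mean value theorem on the line through [y]. Bounding [c] in absolute value
    covers both signs of [s]. *)
Lemma MVT_dir (V : normedModType R) (f : V -> R) (y v : V) (s : R) :
  (forall c, `|c| <= `|s| -> derivable f (y + c *: v) v) ->
  exists2 c, `|c| <= `|s| & f (y + s *: v) - f y = s * 'D_v f (y + c *: v).
Proof.
move=> df.
pose g (t : R) := f (y + t *: v).
have dg (t : R) : `|t| <= `|s| -> is_derive t 1 g ('D_v f (y + t *: v)).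
  by move=> ts; apply: is_derive_line; apply: df.
have cg (a b : R) : (forall t, t \in `[a, b] -> `|t| <= `|s|) ->
    {within `[a, b], continuous g}.
  move=> ab; apply: derivable_within_continuous => t /ab ts.
  by have [] := dg _ ts.
have g0 : g 0 = f y by rewrite /g scale0r addr0.
have [s0|s0] := leP 0 s.
  have le t : t \in `[0, s] -> `|t| <= `|s|.
    by rewrite in_itv/= => /andP[t0 ts]; rewrite !ger0_norm.
  have [||c /le cs e] := @MVT_segment R g (fun t => 'D_v f (y + t *: v)) 0 s s0.
  - by move=> t /subset_itv_oo_cc /le; exact: dg.
  - exact: cg.
  by exists c => //; move: e; rewrite g0 subr0 mulrC.
have le t : t \in `[s, 0] -> `|t| <= `|s|.
  by rewrite in_itv/= => /andP[st t0]; rewrite !ler0_norm ?lerN2// ltW.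
have [||c /le cs e] := @MVT_segment R g (fun t => 'D_v f (y + t *: v)) s 0 (ltW s0).
- by move=> t /subset_itv_oo_cc /le; exact: dg.
- exact: cg.
exists c => //; apply: oppr_inj; rewrite opprB -g0 e sub0r.
by rewrite mulrN mulrC.
Qed.

(** [F] is only derivable along [v]. It is therefore replaced by the curve [c]: in one variable
    derivability is differentiability, and the chain rule for differentials applies to [f \o c]. *)
Lemma derive_comp (U V W : normedModType R) (F : U -> V) (f : V -> W) x v :
  derivable F x v -> differentiable f (F x) ->
  derivable (f \o F) x v /\ 'D_v (f \o F) x = 'd f (F x) ('D_v F x).
Proof.
move=> dF df.
pose c (t : R) := F (x + t *: v).
have c0 : c 0 = F x by rewrite /c scale0r addr0.
have [dc ec] : is_derive (0 : R) 1 c ('D_v F x).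
  have := @is_derive_line _ _ F x v 0; rewrite scale0r addr0; exact.
have Dc := (derivable1_diffP _ _).1 dc.
have df' : differentiable f (c 0) by rewrite c0.
have D := differentiable_comp Dc df'.
have e : (fun h => h^-1 *: ((f \o F \o shift x) (h *: v) - (f \o F) x)) =
  (fun h => h^-1 *: ((f \o c \o shift 0) (h *: (1 : R)) - (f \o c) 0)).
  apply/funext => h /=; rewrite c0 /c; congr (_ *: (f (F _) - _)).
  by rewrite addr0 [h%:A]mulr1 addrC.
split; rewrite /derivable ?[in LHS]/derive e; first exact: diff_derivable D.
rewrite -/(derive (f \o c) 0 1) deriveE// diff_comp//= c0.
by rewrite -ec [in RHS]deriveE.
Qed.

End directional_derivatives.

(** * Differentiability of C^1 functions and symmetry of second derivatives *)

Section Ck.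
Variable R : realType.

Lemma norm_delta n (i : 'I_n) (c : R) :
  `|c *: (delta_mx 0 i : 'rV[R]_n)| <= `|c|.
Proof.
rewrite [leLHS]/Num.Def.normr/= mx_normrE; apply/bigmax_leP; split => // -[a b] _ /=.
rewrite !mxE; case: (_ && _); rewrite ?mulr1 ?mulr0 ?normr0//.
Qed.

Lemma norm_coord n (h : 'rV[R]_n) (i : 'I_n) : `|h 0 i| <= `|h|.
Proof.
rewrite [leRHS]/Num.Def.normr/= mx_normrE.
exact: (@le_bigmax _ _ _ 0 (fun ij : 'I_1 * 'I_n => `|h ij.1 ij.2|) (0, i)).
Qed.

Lemma row_lin_continuous n (W : normedModType R) (w : 'I_n -> W) :
  continuous (fun h : 'rV[R]_n => \sum_i h 0 i *: w i).
Proof.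
move=> h; apply: (@cvg_big W _ _ 0 xpredT _ 'rV[R]_n (nbhs h) _ (fun i (h : 'rV[R]_n) => h 0 i *: w i)) => [|i _].
  exact: add_continuous.
apply: cvgZr_tmp; exact: coord_continuous.
Qed.

Fact row_lin_is_linear n (W : normedModType R) (w : 'I_n -> W) :
  linear (fun h : 'rV[R]_n => \sum_i h 0 i *: w i).
Proof.
move=> a u v; rewrite scaler_sumr -big_split/=; apply: eq_bigr => i _.
by rewrite !mxE scalerDl scalerA.
Qed.

Definition row_lin n (W : normedModType R) (w : 'I_n -> W) : {linear 'rV[R]_n -> W} :=
  HB.pack (fun h : 'rV[R]_n => \sum_i h 0 i *: w i)
    (GRing.isLinear.Build R 'rV[R]_n W *:%R _ (row_lin_is_linear w)).

(** These are the corners of a path from 0 to [h] that changes one coordinate at a time. *)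
Definition trunc_row n (h : 'rV[R]_n) (k : nat) : 'rV[R]_n :=
  \row_j (if (j < k)%N then h 0 j else 0).

Lemma trunc_rowS n (h : 'rV[R]_n) (k : 'I_n) :
  trunc_row h k.+1 = trunc_row h k + h 0 k *: delta_mx 0 k.
Proof.
apply/rowP => j; rewrite !mxE ltnS leq_eqVlt.
have [->|jk] := eqVneq j k; first by rewrite eqxx ltnn/= mulr1 add0r.
by rewrite (inj_eq val_inj) (negbTE jk)/= mulr0 addr0.
Qed.

Lemma norm_trunc_row n (h : 'rV[R]_n) (k : 'I_n) (c : R) :
  `|c| <= `|h 0 k| -> `|trunc_row h k + c *: delta_mx 0 k| <= `|h|.
Proof.
move=> ch; rewrite [leLHS]/Num.Def.normr/= mx_normrE; apply/bigmax_leP; split => // -[a j] _ /=.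
rewrite !mxE (ord1 a) eqxx/=; have [->|jk] := eqVneq j k.
  by rewrite ltnn add0r mulr1 (le_trans ch)// norm_coord.
by rewrite mulr0 addr0; case: ifP => _; rewrite ?normr0// norm_coord.
Qed.

Lemma diff_epsilon (V W : normedModType R) (f : V -> W) (D : {linear V -> W}) x :
  continuous D ->
  (forall e, 0 < e -> \forall h \near 0, `|f (h + x) - (f x + D h)| <= e * `|h|) ->
  differentiable f x.
Proof.
move=> cD H.
have e : f \o shift x = cst (f x) + D +o_ 0 id.
  by apply/eqaddoP => e e0; near=> h; rewrite /=; near: h; exact: H.
by apply/diff_locallyP; rewrite (diff_unique cD e).
Unshelve. all: by end_near. Qed.

(** The increment of [f] telescopes along the corners [x + trunc_row h k]; by the mean value theorem
    each step is a coordinate of [h] times a partial derivative at a point near [x], where it is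
    close to its value at [x]. *)
Lemma C1_differentiable n (U : set 'rV[R]_n) (f : 'rV[R]_n -> R) x :
  open U -> Ck_on 1 U f -> U x -> differentiable f x.
Proof.
move=> oU [_ /= df] Ux.
pose D := row_lin (fun i => pderiv i f x : R).
have cD : continuous D by exact: row_lin_continuous.
apply: (diff_epsilon cD) => e e0.
(* Each of the n steps may contribute an error of [e'] times the norm of [h]; the successor keeps
   the denominator nonzero for n = 0. *)
pose e' := e / n.+1%:R.
have e'0 : 0 < e' by rewrite divr_gt0.
have Hx : \forall z \near x, U z /\ forall i, `|pderiv i f x - pderiv i f z| <= e'.
  near=> z; split; first by near: z; exact: open_nbhs_nbhs.
  near: z; apply: filter_forall => i.
  have /cvgrPdist_le := (df i).2.1 x Ux; exact.
have [r /= r0 Hr] := (nbhs_ballP _ _).1 Hx.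
have {Hr}Hr z : `|z| < r -> U (x + z) /\ forall i, `|pderiv i f x - pderiv i f (x + z)| <= e'.
  by move=> zr; apply: Hr; rewrite mx_norm_ball /ball_/= opprD addNKr normrN.
near=> h.
have hr : `|h| < r.
  near: h; apply/nbhs_ballP; exists r => //= y.
  by rewrite mx_norm_ball /ball_/= sub0r normrN.
have -> : f (h + x) = f x + \sum_(k < n) (f (x + trunc_row h k.+1) - f (x + trunc_row h k)).
  rewrite -(big_mkord xpredT (fun k => f (x + trunc_row h k.+1) - f (x + trunc_row h k))).
  rewrite telescope_sumr// [in RHS]addrCA.
  have -> : trunc_row h n = h by apply/rowP => j; rewrite mxE ltn_ord.
  have -> : trunc_row h 0 = 0 by apply/rowP => j; rewrite !mxE.
  by rewrite addr0 subrr addr0 addrC.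
rewrite opprD addrACA subrr add0r -sumrB.
apply: (@le_trans _ _ (\sum_(k < n) e' * `|h|)); last first.
  rewrite sumr_const card_ord -mulr_natr mulrAC ler_wpM2r// /e'.
  by rewrite -mulrA ler_piMr ?(ltW e0)// mulrC ler_pdivrMr// mul1r ler_nat.
apply: (le_trans (ler_norm_sum _ _ _)); apply: ler_sum => k _.
rewrite trunc_rowS addrA.
have Hc c : `|c| <= `|h 0 k| ->
    U (x + trunc_row h k + c *: delta_mx 0 k) /\ forall i,
    `|pderiv i f x - pderiv i f (x + trunc_row h k + c *: delta_mx 0 k)| <= e'.
  move=> ch; rewrite -addrA; apply: Hr.
  by rewrite (le_lt_trans _ hr)// norm_trunc_row.
have [c ch ->] : exists2 c, `|c| <= `|h 0 k| & f (x + trunc_row h k + h 0 k *: delta_mx 0 k) -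
    f (x + trunc_row h k) = h 0 k * pderiv k f (x + trunc_row h k + c *: delta_mx 0 k).
  by apply: MVT_dir => c /Hc [Uc _]; apply: (df k).1.
have [_ /(_ k)] := Hc c ch.
rewrite [in leLHS]/GRing.scale/= -mulrBr normrM mulrC distrC => le.
by rewrite ler_pM// norm_coord.
Unshelve. all: by end_near. Qed.

Lemma derive_C1 n (U : set 'rV[R]_n) (f : 'rV[R]_n -> R) x v :
  open U -> Ck_on 1 U f -> U x ->
  'd f x v = \sum_i v 0 i * pderiv i f x.
Proof.
move=> oU f1 Ux; have df := C1_differentiable oU f1 Ux.
rewrite {1}(row_sum_delta v) linear_sum/=; apply: eq_bigr => i _.
by rewrite linearZ/= -deriveE.
Qed.

(** The mean value theorem is applied first along [ei] to [g], the increment of [f] along [ej], and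
    then along [ej] to the i-th partial derivative. *)
Lemma second_difference n (U : set 'rV[R]_n) (f : 'rV[R]_n -> R) (i j : 'I_n)
    (x : 'rV[R]_n) (s : R) :
  Ck_on 2 U f ->
  (forall a b, `|a| <= `|s| -> `|b| <= `|s| ->
    U (x + a *: delta_mx 0 i + b *: delta_mx 0 j)) ->
  exists a b, [/\ `|a| <= `|s|, `|b| <= `|s| &
   f (x + s *: delta_mx 0 i + s *: delta_mx 0 j) - f (x + s *: delta_mx 0 i)
   - (f (x + s *: delta_mx 0 j) - f x)
   = s * s * pderiv j (pderiv i f) (x + a *: delta_mx 0 i + b *: delta_mx 0 j)].
Proof.
move=> [_ f2] HU; set ei := delta_mx 0 i; set ej := delta_mx 0 j.
have HU0 a : `|a| <= `|s| -> U (x + a *: ei).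
  by move=> as_; have := HU a 0 as_; rewrite scale0r addr0 normr0; apply.
pose g y := f (y + s *: ej) - f y.
have d1 a : `|a| <= `|s| -> derivable f (x + a *: ei + s *: ej) ei.
  by move=> as_; apply: (f2 i).1; exact: HU.
have d2 a : `|a| <= `|s| -> derivable f (x + a *: ei) ei.
  by move=> as_; apply: (f2 i).1; exact: HU0.
have [|a as_ e] := @MVT_dir _ _ g x ei s.
  by move=> a as_; apply: derivableB; [apply: derivable_shift; exact: d1|exact: d2].
have [|b bs_ e'] := @MVT_dir _ _ (pderiv i f) (x + a *: ei) ej s.
  by move=> b bs_; apply: ((f2 i).2.2 j).1; exact: HU.
exists a, b; split => //.
transitivity (g (x + s *: ei) - g x) => //.
rewrite e /g deriveB; [|by apply: derivable_shift; exact: d1|exact: d2].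
by rewrite derive_shiftE -/(pderiv i f _) -/(pderiv i f _) e' mulrA.
Qed.

Lemma close_halves (A B C D e : R) :
  C = D -> `|A - C| <= e / 2 -> `|B - D| <= e / 2 -> `|A - B| <= e.
Proof.
move=> <- h1 h2.
have -> : A - B = (A - C) - (B - C) by ring.
by rewrite (le_trans (ler_normB _ _))// (splitr e) lerD.
Qed.

(** The second difference is symmetric in [i] and [j], so the two mixed derivatives coincide at two
    possibly different points near [x]; continuity brings both points to [x]. *)
Lemma schwarz n (U : set 'rV[R]_n) (f : 'rV[R]_n -> R) (i j : 'I_n) x :
  open U -> Ck_on 2 U f -> U x ->
  pderiv i (pderiv j f) x = pderiv j (pderiv i f) x.
Proof.
move=> oU f2 Ux; apply/eqP; rewrite -subr_eq0 -normr_le0.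
apply/ler_addgt0Pl => e e0; rewrite addr0.
have [_ /= f2'] := f2.
have Hx : \forall z \near x, [/\ U z,
   `|pderiv i (pderiv j f) x - pderiv i (pderiv j f) z| <= e / 2 &
   `|pderiv j (pderiv i f) x - pderiv j (pderiv i f) z| <= e / 2].
  have H : \forall z \near x, U z by exact: open_nbhs_nbhs.
  have H1 : \forall z \near x, `|pderiv i (pderiv j f) x - pderiv i (pderiv j f) z| <= e / 2.
    by have /cvgrPdist_le := ((f2' j).2.2 i).2.1 x Ux; apply; rewrite divr_gt0.
  have H2 : \forall z \near x, `|pderiv j (pderiv i f) x - pderiv j (pderiv i f) z| <= e / 2.
    by have /cvgrPdist_le := ((f2' i).2.2 j).2.1 x Ux; apply; rewrite divr_gt0.
  by apply: filterS3 H H1 H2 => z.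
have [r /= r0 Hb] := (nbhs_ballP _ _).1 Hx.
(* Two displacements of norm at most r/4 stay within the ball of radius r. *)
pose s := r / 4.
have s0 : 0 < s by rewrite divr_gt0.
have Hr k l a b : `|a| <= `|s| -> `|b| <= `|s| ->
  ball x r (x + a *: delta_mx 0 k + b *: delta_mx 0 l).
  move=> as_ bs_; rewrite mx_norm_ball /ball_/= -addrA opprD addNKr normrN.
  rewrite (le_lt_trans (ler_normD _ _))//.
  rewrite (@le_lt_trans _ _ (`|s| + `|s|))//.
    by rewrite lerD// (le_trans (norm_delta _ _)).
  by rewrite gtr0_norm// /s; lra.
have U1 k l a b : `|a| <= `|s| -> `|b| <= `|s| -> U (x + a *: delta_mx 0 k + b *: delta_mx 0 l).
  by move=> as_ bs_; have [] := Hb _ (Hr k l a b as_ bs_).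
have [a [b [as_ bs_ e1]]] := second_difference f2 (U1 i j).
have [a' [b' [as'_ bs'_ e2]]] := second_difference f2 (U1 j i).
have sub4 (A B C D : R) : A - B - (C - D) = A - C - (B - D) by ring.
have : s * s * pderiv j (pderiv i f) (x + a *: delta_mx 0 i + b *: delta_mx 0 j)
  = s * s * pderiv i (pderiv j f) (x + a' *: delta_mx 0 j + b' *: delta_mx 0 i).
  refine (etrans (esym e1) (etrans _ e2)).
  rewrite (addrAC x (s *: delta_mx 0 j)); exact: sub4.
have ss0 : s * s != 0 by rewrite mulf_neq0// gt_eqF.
move=> /(mulfI ss0) E.
have [_ _ h1] := Hb _ (Hr i j a b as_ bs_).
have [_ h2 _] := Hb _ (Hr j i a' b' as'_ bs'_).
exact: (close_halves (esym E) h2 h1).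
Qed.
End Ck.

(** * Closure properties of C^k functions *)

Section Ck_closure.
Variable R : realType.

Lemma near_open (T : topologicalType) (U : set T) (P : T -> Prop) x :
  open U -> U x -> (forall y, U y -> P y) -> \near x, P x.
Proof. by move=> oU Ux UP; apply: filterS (UP) _; exact: open_nbhs_nbhs. Qed.

Lemma continuous_open_ext (T W : topologicalType) (U : set T) (f g : T -> W) x :
  open U -> U x -> (forall y, U y -> f y = g y) ->
  {for x, continuous f} -> {for x, continuous g}.
Proof.
move=> oU Ux fg cf; rewrite /prop_for/continuous_at -fg//.
apply: cvg_trans cf; apply: near_eq_cvg.
by apply: near_open oU Ux _ => y /fg.
Qed.

Lemma pderiv_open n (W : normedModType R) (U : set 'rV[R]_n) (f g : 'rV[R]_n -> W) i x :
  open U -> U x -> (forall y, U y -> f y = g y) -> pderiv i f x = pderiv i g x.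
Proof. by move=> oU Ux fg; apply: near_eq_derive; exact: near_open oU Ux fg. Qed.

Lemma Ck_on_ext n (W : normedModType R) (U : set 'rV[R]_n) k (f g : 'rV[R]_n -> W) :
  open U -> (forall y, U y -> f y = g y) -> Ck_on k U f -> Ck_on k U g.
Proof.
move=> oU; elim: k f g => [|k IH] f g fg [cf df]; split => //=.
- by move=> x Ux; exact: continuous_open_ext oU Ux fg (cf x Ux).
- by move=> x Ux; exact: continuous_open_ext oU Ux fg (cf x Ux).
- move=> i; have [df1 df2] := df i; split.
    by move=> x Ux; apply: near_eq_derivable (df1 x Ux); exact: near_open oU Ux fg.
  by apply: IH df2 => y Uy; exact: pderiv_open oU Uy fg.
Qed.

Lemma Ck_onW n (W : normedModType R) (U : set 'rV[R]_n) k (f : 'rV[R]_n -> W) :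
  Ck_on k.+1 U f -> Ck_on k U f.
Proof.
elim: k f => [|k IH] f [cf df]; split => //= i.
by have [d1 d2] := df i; split => //; exact: IH.
Qed.

Lemma Ck_on1 n (W : normedModType R) (U : set 'rV[R]_n) k (f : 'rV[R]_n -> W) :
  Ck_on k.+1 U f -> Ck_on 1 U f.
Proof. by elim: k => // k IH /Ck_onW. Qed.

Lemma Ck_on_cst n (W : normedModType R) (U : set 'rV[R]_n) k (c : W) :
  Ck_on k U (fun _ : 'rV[R]_n => c).
Proof.
have cc (d : W) : forall x, U x -> {for x, continuous (fun _ : 'rV[R]_n => d)}.
  by move=> x _; exact: (@cst_continuous _ _ d x).
elim: k c => [|k IH] c; split => //=; try exact: cc.
move=> i.
split=> [x _|]; first exact: derivable_cst.
have -> : pderiv i (fun _ : 'rV[R]_n => c) = fun=> 0 by apply/funext => x; exact: derive_cst.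
exact: IH.
Qed.

Lemma Ck_onD n (U : set 'rV[R]_n) k (f g : 'rV[R]_n -> R) :
  open U -> Ck_on k U f -> Ck_on k U g -> Ck_on k U (fun x => f x + g x).
Proof.
move=> oU; elim: k f g => [|k IH] f g [cf df] [cg dg]; split => //=;
  try by move=> x Ux; apply: continuousD; [exact: cf|exact: cg].
move=> i; have [df1 df2] := df i; have [dg1 dg2] := dg i; split.
  by move=> x Ux; apply: derivableD; [exact: df1|exact: dg1].
apply: Ck_on_ext oU _ (IH _ _ df2 dg2) => y Uy /=.
by rewrite -[LHS](@deriveD _ _ _ f g)//; [exact: df1|exact: dg1].
Qed.

Lemma pderivM n (f g : 'rV[R]_n -> R) i x :
  derivable f x (delta_mx 0 i) -> derivable g x (delta_mx 0 i) ->
  pderiv i (fun y => f y * g y) x = pderiv i f x * g x + f x * pderiv i g x.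
Proof.
move=> df dg; refine (etrans (deriveM df dg) _); rewrite [RHS]addrC.
by congr (_ + _); exact: mulrC.
Qed.

Lemma Ck_onM n (U : set 'rV[R]_n) k (f g : 'rV[R]_n -> R) :
  open U -> Ck_on k U f -> Ck_on k U g -> Ck_on k U (fun x => f x * g x).
Proof.
move=> oU; elim: k f g => [|k IH] f g f1 g1; have [cf df] := f1; have [cg dg] := g1;
  split => //=; try by move=> x Ux; apply: continuousM; [exact: cf|exact: cg].
move=> i; have [df1 df2] := df i; have [dg1 dg2] := dg i; split.
  by move=> x Ux; apply: derivableM; [exact: df1|exact: dg1].
apply: Ck_on_ext oU _ (Ck_onD oU (IH _ _ df2 (Ck_onW g1)) (IH _ _ (Ck_onW f1) dg2)) => y Uy /=.
by rewrite pderivM//; [exact: df1|exact: dg1].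
Qed.

Lemma Ck_on_sum n (U : set 'rV[R]_n) k (I : Type) (r : seq I) (f : I -> 'rV[R]_n -> R) :
  open U -> (forall i, Ck_on k U (f i)) -> Ck_on k U (fun x => \sum_(i <- r) f i x).
Proof.
move=> oU fk; elim: r => [|a r IH].
  by apply: Ck_on_ext oU _ (Ck_on_cst U k 0) => y Uy; rewrite big_nil.
by apply: Ck_on_ext oU _ (Ck_onD oU (fk a) IH) => y Uy; rewrite big_cons.
Qed.

Lemma pderiv_coord m n (F : 'rV[R]_m -> 'rV[R]_n) i a x :
  derivable F x (delta_mx 0 i) ->
  pderiv i (fun y => F y 0 a) x = pderiv i F x 0 a.
Proof. by move=> dF; rewrite /pderiv derive_mx// mxE. Qed.

Lemma Ck_on_coord m n (U : set 'rV[R]_m) k (F : 'rV[R]_m -> 'rV[R]_n) a :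
  open U -> Ck_on k U F -> Ck_on k U (fun x => F x 0 a).
Proof.
move=> oU; elim: k F => [|k IH] F [cF dF]; split => //=; try by
  move=> x Ux; apply: (@continuous_comp _ _ _ F (fun v : 'rV[R]_n => v 0 a));
  [exact: cF|exact: coord_continuous].
move=> i; have [dF1 dF2] := dF i; split.
  by move=> x Ux; exact: (derivable_mxP _ _ _).1 (dF1 x Ux) 0 a.
by apply: Ck_on_ext oU _ (IH _ dF2) => y Uy; rewrite pderiv_coord//; exact: dF1.
Qed.

Lemma pderiv_comp m n (V : set 'rV[R]_n) (F : 'rV[R]_m -> 'rV[R]_n) (f : 'rV[R]_n -> R) x i :
  open V -> Ck_on 1 V f -> V (F x) -> derivable F x (delta_mx 0 i) ->
  derivable (f \o F) x (delta_mx 0 i) /\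
  pderiv i (f \o F) x = \sum_a pderiv i F x 0 a * pderiv a f (F x).
Proof.
move=> oV f1 VF dF.
have [d e] := derive_comp dF (C1_differentiable oV f1 VF).
by split=> //; rewrite /pderiv e (derive_C1 _ oV f1).
Qed.

(** By the chain rule the partial derivatives are sums of products of those of [F] with the
    compositions [pderiv a f \o F], to which the induction hypothesis applies. *)
Lemma Ck_on_comp m n (U : set 'rV[R]_m) (V : set 'rV[R]_n) k
    (F : 'rV[R]_m -> 'rV[R]_n) (f : 'rV[R]_n -> R) :
  open U -> open V -> (forall x, U x -> V (F x)) ->
  Ck_on k U F -> Ck_on k V f -> Ck_on k U (f \o F).
Proof.
move=> oU oV UV; elim: k F f UV => [|k IH] F f UV F1 f1; have [cF dF] := F1; have [cf df] := f1;
  split => //=; try by move=> x Ux; apply: continuous_comp; [exact: cF|apply: cf; exact: UV].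
move=> i; have [dF1 dF2] := dF i; split.
  move=> x Ux; have [] := pderiv_comp oV (Ck_on1 f1) (UV _ Ux) (dF1 _ Ux) => //.
have H : Ck_on k U (fun x => \sum_a pderiv i F x 0 a * (pderiv a f \o F) x).
  apply: Ck_on_sum => // a; apply: Ck_onM => //; first exact: Ck_on_coord.
  by apply: IH => //; [exact: Ck_onW|exact: (df a).2].
apply: Ck_on_ext oU _ H => y Uy.
by have [_ ->] := pderiv_comp oV (Ck_on1 f1) (UV _ Uy) (dF1 _ Uy).
Qed.

Lemma Ck_on_derivable n (W : normedModType R) (U : set 'rV[R]_n) k (f : 'rV[R]_n -> W) i x :
  Ck_on k.+1 U f -> U x -> derivable f x (delta_mx 0 i).
Proof. by move=> [_ df] Ux; exact: (df i).1. Qed.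

Lemma derivable_det n m (A : 'rV[R]_n -> 'M[R]_m) x v :
  (forall i j, derivable (fun y => A y i j) x v) -> derivable (fun y => \det (A y)) x v.
Proof.
move=> dA.
have dP (s : 'I_m -> 'I_m) (r : seq 'I_m) : derivable (fun y => \prod_(i <- r) A y i (s i)) x v.
  elim: r => [|a r IH].
    by under eq_fun do rewrite big_nil; exact: derivable_cst.
  under eq_fun do rewrite big_cons; exact: derivableM.
rewrite /determinant; elim: (index_enum _) => [|s r IH].
  by under eq_fun do rewrite big_nil; exact: derivable_cst.
under eq_fun do rewrite big_cons; apply: derivableD => //.
exact: derivableM (derivable_cst _ _ _) (dP _ _).
Qed.

(** Cramer's rule. [invmx] is given by cofactors only on [unitmx], so invertibility is required in a
    neighbourhood. *)
Lemma derivable_invmx n m (A : 'rV[R]_n -> 'M[R]_m) x v k l :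
  (\near x, A x \in unitmx) ->
  (forall i j, derivable (fun y => A y i j) x v) ->
  derivable (fun y => invmx (A y) k l) x v.
Proof.
move=> Au dA.
have d : derivable (fun y => (\det (A y))^-1 * cofactor (A y) l k) x v.
  apply: derivableM.
    apply: derivableV; last exact: derivable_det.
    by rewrite -unitfE -unitmxE; exact: nbhs_singleton Au.
  apply: derivableM; first exact: derivable_cst.
  apply: derivable_det => i j.
  by under eq_fun do rewrite !mxE; exact: dA.
apply: near_eq_derivable d; apply: filterS Au => y Ay.
by rewrite /invmx Ay !mxE.
Qed.

End Ck_closure.

(** * Locally affine maps and exponentials *)

Section affine_maps.
Variable R : realType.

Lemma row_lin_delta n (W : normedModType R) (w : 'I_n -> W) i :
  row_lin w (delta_mx 0 i) = w i.
Proof.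
rewrite /= (bigD1 i)//= mxE !eqxx scale1r big1 ?addr0// => j ji.
by rewrite mxE (negbTE ji) andbF scale0r.
Qed.

Lemma row_lin_id n (x : 'rV[R]_n) : row_lin (fun i => delta_mx 0 i : 'rV[R]_n) x = x.
Proof. by rewrite /= -row_sum_delta. Qed.

Lemma pderiv_affine n (W : normedModType R) (f : 'rV[R]_n -> W) (w : 'I_n -> W) d x i :
  (\forall y \near x, f y = row_lin w y + d) ->
  derivable f x (delta_mx 0 i) /\ pderiv i f x = w i.
Proof.
move=> fE.
have dL : differentiable (row_lin w : 'rV[R]_n -> W) x.
  by apply: linear_differentiable; exact: row_lin_continuous.
have d1 : is_derive x (delta_mx 0 i) (row_lin w : 'rV[R]_n -> W) (w i).
  split; first exact: diff_derivable.
  by rewrite deriveE// diff_lin ?row_lin_delta//; exact: row_lin_continuous.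
have d2 : is_derive x (delta_mx 0 i) (fun y : 'rV[R]_n => row_lin w y + d) (w i).
  rewrite -[w i]addr0; exact: is_deriveD d1 (is_derive_cst d x (delta_mx 0 i)).
have fE' : \forall y \near x, row_lin w y + d = f y by apply: filterS fE => y ->.
by have [? ?] := near_eq_is_derive fE' d2.
Qed.

(** The constant [d] may vary with the point: transition maps of the torus are translations by a
    vector that is only locally constant. The partial derivatives are nevertheless the global
    constants [w i]. *)
Lemma smooth_affine n (W : normedModType R) (U : set 'rV[R]_n) (f : 'rV[R]_n -> W) (w : 'I_n -> W) :
  open U -> (forall x, U x -> exists d, \forall y \near x, f y = row_lin w y + d) ->
  smooth_on U f.
Proof.
move=> oU fE.
have fc x : U x -> {for x, continuous f}.
  move=> /fE[d fd].
  have cL : {for x, continuous (fun y : 'rV[R]_n => row_lin w y + d)}.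
    apply: continuousD; last exact: (@cst_continuous _ _ d x).
    exact: row_lin_continuous.
  rewrite /prop_for/continuous_at (nbhs_singleton fd).
  have fd' : \forall y \near x, row_lin w y + d = f y by apply: filterS fd => y ->.
  exact: cvg_trans (near_eq_cvg fd') cL.
case=> [|k]; split => //= i; split=> [x /fE[d fd]|].
  by have [] := pderiv_affine i fd.
apply: Ck_on_ext oU _ (Ck_on_cst U k (w i)) => y /fE[d fd].
by have [_ ->] := pderiv_affine i fd.
Qed.

Lemma smooth_coord n (U : set 'rV[R]_n) a : open U -> smooth_on U (fun x : 'rV[R]_n => x 0 a).
Proof.
move=> oU; apply: (smooth_affine (w := fun i => (i == a)%:R : R)) => // x _; exists 0.
near=> y; rewrite addr0 /= (bigD1 a)//= eqxx big1 ?addr0; first exact/esym/mulr1.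
by move=> i ia; rewrite (negbTE ia); exact: mulr0.
Unshelve. all: by end_near. Qed.

Lemma Ck_on_expR n (U : set 'rV[R]_n) k (u : 'rV[R]_n -> R) :
  open U -> Ck_on k U u -> Ck_on k U (fun x => expR (u x)).
Proof.
move=> oU; elim: k => [|k IH] uk; have [cu du] := uk; split => //=;
  try by move=> x Ux; apply: (@continuous_comp _ _ _ u expR); [exact: cu|exact: continuous_expR].
have D x i : U x -> derivable (fun x => expR (u x)) x (delta_mx 0 i) /\
    pderiv i (fun x => expR (u x)) x = pderiv i u x * expR (u x).
  move=> Ux; have dE : differentiable (expR : R -> R) (u x).
    by apply/derivable1_diffP; exact: derivable_expR.
  have [d1 e1] := derive_comp ((du i).1 x Ux) dE.
  split; first exact: d1.
  refine (etrans e1 _); rewrite -/(pderiv i u x) -{1}[pderiv i u x]mulr1.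
  rewrite -[_ * 1]/(_ *: (1 : R)) linearZ/= -deriveE//.
  by have [_ ->] : is_derive (u x) 1 (expR : R -> R) (expR (u x)) by exact: is_derive_expR.
move=> i; split=> [x Ux|]; first by have [] := D x i Ux.
apply: Ck_on_ext oU _ (Ck_onM oU (du i).2 (IH (Ck_onW uk))) => y Uy.
by have [_ ->] := D y i Uy.
Qed.
End affine_maps.


(** * Symmetries of the curvature *)

Section local_geometry.
Variable R : realType.

Lemma pderiv_sum n (I : Type) (r : seq I) (f : I -> 'rV[R]_n -> R) i x :
  (forall a, derivable (f a) x (delta_mx 0 i)) ->
  derivable (fun y => \sum_(a <- r) f a y) x (delta_mx 0 i) /\
  pderiv i (fun y => \sum_(a <- r) f a y) x = \sum_(a <- r) pderiv i (f a) x.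
Proof.
move=> df; elim: r => [|a r [IH1 IH2]].
  under eq_fun do rewrite big_nil; rewrite big_nil.
  by split; [exact: derivable_cst|exact: derive_cst].
under eq_fun do rewrite big_cons; rewrite big_cons; split; first exact: derivableD.
by rewrite -IH2; exact: (deriveD (df a) IH1).
Qed.

Lemma pderivD n (f g : 'rV[R]_n -> R) i x :
  derivable f x (delta_mx 0 i) -> derivable g x (delta_mx 0 i) ->
  pderiv i (fun y => f y + g y) x = pderiv i f x + pderiv i g x.
Proof. by move=> df dg; refine (etrans (deriveD df dg) _). Qed.

(** Christoffel symbols of the first kind. They are linear in the derivatives of the metric and
    contain no inverse metric. *)
Definition christoffel1 n (g : 'rV[R]_n -> 'M[R]_n) (k i j : 'I_n) (x : 'rV[R]_n) : R :=
  2^-1 * (pderiv i (fun y => g y j k) x + pderiv j (fun y => g y i k) x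
          - pderiv k (fun y => g y i j) x).

Lemma christoffelE n (g : 'rV[R]_n -> 'M[R]_n) (k i j : 'I_n) (x : 'rV[R]_n) :
  christoffel g k i j x = \sum_l invmx (g x) k l * christoffel1 g l i j x.
Proof.
by rewrite /christoffel mulr_sumr; apply: eq_bigr => l _; rewrite mulrCA.
Qed.

Section smooth_metric.
Variables (n : nat) (U : set 'rV[R]_n) (g : 'rV[R]_n -> 'M[R]_n).
Hypotheses (oU : open U) (gs : forall i j, Ck_on 2 U (fun y => g y i j)).
Hypotheses (gsym : forall y i j, U y -> g y i j = g y j i).

Lemma pderiv_metricC k i j y : U y ->
  pderiv k (fun z => g z i j) y = pderiv k (fun z => g z j i) y.
Proof. by move=> Uy; apply: pderiv_open oU Uy _ => z Uz; exact: gsym. Qed.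

Lemma christoffel1C k i j y : U y -> christoffel1 g k i j y = christoffel1 g k j i y.
Proof.
move=> Uy; rewrite /christoffel1 (pderiv_metricC k i j Uy).
by rewrite [pderiv i _ y + _]addrC.
Qed.

Lemma christoffelC k i j y : U y -> christoffel g k i j y = christoffel g k j i y.
Proof.
by move=> Uy; rewrite !christoffelE; apply: eq_bigr => l _; rewrite christoffel1C.
Qed.

(** This is nabla g = 0 in coordinates. *)
Lemma metric_compat k i j y : U y ->
  christoffel1 g k i j y + christoffel1 g j i k y = pderiv i (fun z => g z j k) y.
Proof.
move=> Uy; rewrite /christoffel1 (pderiv_metricC i k j Uy) (pderiv_metricC k i j Uy).
rewrite (pderiv_metricC k j i Uy); set a := pderiv i _ y; set b := pderiv j _ y.
set c := pderiv k _ y; by field.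
Qed.

Hypothesis gU : forall y, U y -> g y \in unitmx.

Lemma invmx_sym y i j : U y -> invmx (g y) i j = invmx (g y) j i.
Proof.
move=> Uy; have e : (g y)^T = g y by apply/matrixP => a b; rewrite mxE gsym.
by rewrite -{1}e -trmx_inv mxE.
Qed.

Lemma lower_christoffel k i j y : U y ->
  \sum_p g y k p * christoffel g p i j y = christoffel1 g k i j y.
Proof.
move=> Uy.
transitivity ((g y *m (invmx (g y) *m (\col_l christoffel1 g l i j y))) k 0); last first.
  by rewrite mulmxA mulmxV ?gU// mul1mx mxE.
rewrite mxE; apply: eq_bigr => p _; rewrite christoffelE mxE; congr (_ * _).
by apply: eq_bigr => l _; rewrite !mxE.
Qed.

Lemma derivable_christoffel1 k i j y v : U y ->
  derivable (christoffel1 g k i j) y (delta_mx 0 v).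
Proof.
move=> Uy; have d a b c : derivable (pderiv a (fun z => g z b c)) y (delta_mx 0 v).
  by apply: (Ck_on_derivable (U := U) (k := 0)) => //; exact: ((gs b c).2 a).2.
apply: derivableM; first exact: derivable_cst.
by apply: derivableB; first exact: derivableD.
Qed.

Lemma derivable_christoffel k i j y v : U y ->
  derivable (christoffel g k i j) y (delta_mx 0 v).
Proof.
move=> Uy.
have H l : derivable (fun y => invmx (g y) k l * christoffel1 g l i j y) y (delta_mx 0 v).
  apply: derivableM; last exact: derivable_christoffel1.
  apply: derivable_invmx; first exact: near_open oU Uy gU.
  by move=> a b; exact: Ck_on_derivable (gs a b) Uy.
have [d _] := pderiv_sum (index_enum _) H.
have -> : christoffel g k i j = (fun y => \sum_l invmx (g y) k l * christoffel1 g l i j y).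
  by apply/funext => z; exact: christoffelE.
exact: d.
Qed.

(** The inner product of nabla_i d_k and nabla_j d_l, which accounts for the symmetry in the next
    lemma. *)
Definition christoffel_pairing i k j l y :=
  \sum_p christoffel1 g p i k y * christoffel g p j l y.

Lemma christoffel_pairingC i k j l y : U y ->
  christoffel_pairing i k j l y = christoffel_pairing j l i k y.
Proof.
move=> Uy; rewrite /christoffel_pairing.
under eq_bigr do rewrite christoffelE mulr_sumr.
under [RHS]eq_bigr do rewrite christoffelE mulr_sumr.
rewrite exchange_big/=; apply: eq_bigr => p _; apply: eq_bigr => q _.
rewrite (invmx_sym q p Uy).
have sw (u v w : R) : u * (v * w) = w * (v * u) by ring.
exact: sw.
Qed.

(** The Leibniz rule for the lowered symbol, the derivative of the metric being expressed by
    [metric_compat]. *)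
Lemma lower_pderiv_christoffel i k j l x : U x ->
  \sum_p g x k p * pderiv i (christoffel g p j l) x =
  pderiv i (christoffel1 g k j l) x
  - \sum_p christoffel1 g k i p x * christoffel g p j l x
  - christoffel_pairing i k j l x.
Proof.
move=> Ux.
have dg p : derivable (fun y => g y k p) x (delta_mx 0 i).
  exact: Ck_on_derivable (gs k p) Ux.
have dG p : derivable (christoffel g p j l) x (delta_mx 0 i).
  exact: derivable_christoffel.
have [_ e] := pderiv_sum (index_enum _) (fun p => derivableM (dg p) (dG p)).
have -> : pderiv i (christoffel1 g k j l) x =
  \sum_p pderiv i (fun y => g y k p * christoffel g p j l y) x.
  rewrite -[RHS]e; apply: pderiv_open oU Ux _ => y Uy.
  by rewrite -lower_christoffel.
rewrite /christoffel_pairing -!sumrB; apply: eq_bigr => p _.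
rewrite pderivM// (pderiv_metricC i k p Ux) -(metric_compat k i p Ux).
by ring.
Qed.

(* Only derivatives of first-kind symbols and a term quadratic in them remain;
   the latter is symmetric under exchange of the two pairs of lower indices. *)
Lemma riemannE i j k l x : U x ->
  riemann g i j k l x =
  pderiv i (christoffel1 g k j l) x - pderiv j (christoffel1 g k i l) x
  - christoffel_pairing i k j l x + christoffel_pairing j k i l x.
Proof.
move=> Ux; rewrite /riemann /riemann_up.
have e a b c : \sum_p g x k p * \sum_q christoffel g p a q x * christoffel g q b c x =
   \sum_q christoffel1 g k a q x * christoffel g q b c x.
  under eq_bigr do rewrite mulr_sumr.
  rewrite exchange_big/=; apply: eq_bigr => q _.
  under eq_bigr do rewrite mulrA; rewrite -mulr_suml.
  by rewrite lower_christoffel.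
have alg4 (z a b c d : R) : z * (a - b + (c - d)) = z * a - z * b + z * c - z * d by ring.
transitivity (\sum_p g x k p * pderiv i (christoffel g p j l) x
  - \sum_p g x k p * pderiv j (christoffel g p i l) x
  + \sum_p g x k p * (\sum_q christoffel g p i q x * christoffel g q j l x)
  - \sum_p g x k p * (\sum_q christoffel g p j q x * christoffel g q i l x)).
  rewrite -!sumrB -big_split/= -sumrB; apply: eq_bigr => p _.
  by rewrite sumrB alg4.
have alg6 (a b u v s t A B C D : R) : A = a - u - s -> B = b - v - t -> C = u -> D = v ->
    A - B + C - D = a - b - s + t by move=> -> -> -> ->; ring.
exact: (alg6 _ _ _ _ _ _ _ _ _ _ (lower_pderiv_christoffel i k j l Ux)
  (lower_pderiv_christoffel j k i l Ux) (e i j l) (e j i l)).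
Qed.

(** Symmetrizing the first-kind symbols in [k] and [l] gives a derivative of the metric by
    [metric_compat]. The derivative terms then amount to a commutator of partial derivatives, zero
    by [schwarz], and the quadratic terms cancel by [christoffel_pairingC]. *)
Lemma riemann_antisym_last i j k l x : U x ->
  riemann g i j k l x = - riemann g i j l k x.
Proof.
move=> Ux.
have e a b : pderiv a (christoffel1 g k b l) x + pderiv a (christoffel1 g l b k) x =
   pderiv a (pderiv b (fun z => g z l k)) x.
  transitivity (pderiv a (fun z => christoffel1 g k b l z + christoffel1 g l b k z) x).
    by rewrite pderivD//; exact: derivable_christoffel1.
  by apply: pderiv_open oU Ux _ => y Uy; exact: metric_compat.
have alg (X Y a b c d s1 s2 t1 t2 : R) : X = a - c - s1 + s2 -> Y = b - d - t2 + t1 ->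
    s1 = t1 -> s2 = t2 -> a + b = c + d -> X = - Y.
  move=> -> -> -> -> H; apply/eqP; rewrite -subr_eq0 opprK; apply/eqP.
  by transitivity (a + b - (c + d)); [ring|rewrite H subrr].
apply: (alg _ _ _ _ _ _ _ _ _ _ (riemannE i j k l Ux) (riemannE i j l k Ux)
  (christoffel_pairingC i k j l Ux) (christoffel_pairingC j k i l Ux)).
refine (etrans (e i j) (etrans _ (esym (e j i)))).
exact: schwarz oU (gs l k) Ux.
Qed.

Lemma riemann_antisym_first i j k l x : riemann g i j k l x = - riemann g j i k l x.
Proof.
rewrite /riemann -sumrN; apply: eq_bigr => p _; rewrite -mulrN; congr (_ * _).
rewrite /riemann_up !sumrB.
have alg (a b c d : R) : a - b + (c - d) = - (b - a + (d - c)) by ring.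
exact: alg.
Qed.

End smooth_metric.
End local_geometry.

(* Unfolding partial derivatives makes failing unifications diverge. *)
#[local] Opaque pderiv.

(** * Immersions read in coordinates *)

Section immersions.
Variable R : realType.

Lemma innerE n (A : 'M[R]_n) (v w : 'rV[R]_n) : inner A v w = (v *m A *m w^T) 0 0.
Proof.
rewrite /inner mxE exchange_big/=; apply: eq_bigr => b _.
rewrite !mxE mulr_suml; apply: eq_bigr => a _.
by rewrite [A a b * _]mulrC.
Qed.

Lemma inner_scale n (c : R) (A : 'M[R]_n) v w : inner (c *: A) v w = c * inner A v w.
Proof. by rewrite !innerE -scalemxAr -scalemxAl mxE. Qed.

Lemma innerZl n (c : R) (A : 'M[R]_n) v w : inner A (c *: v) w = c * inner A v w.
Proof. by rewrite !innerE -!scalemxAl mxE. Qed.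

Lemma innerZr n (c : R) (A : 'M[R]_n) v w : inner A v (c *: w) = c * inner A v w.
Proof. by rewrite !innerE linearZ/= -scalemxAr mxE. Qed.

Lemma inner_sym n (A : 'M[R]_n) v w : (forall i j, A i j = A j i) -> inner A v w = inner A w v.
Proof.
move=> As; rewrite /inner exchange_big/=.
apply: eq_bigr => a _; apply: eq_bigr => b _.
by rewrite (As b a) mulrAC.
Qed.

Lemma posdef_unitmx n (A : 'M[R]_n) :
  (forall v, v != 0 -> 0 < inner A v v) -> A \in unitmx.
Proof.
move=> pA; rewrite -row_free_unit; apply: inj_row_free => v vA.
apply/eqP; apply: contraT => v0.
by have := pA v v0; rewrite innerE vA mul0mx mxE ltxx.
Qed.

Lemma pullbackE m n (G : 'rV[R]_n -> 'M[R]_n) (F : 'rV[R]_m -> 'rV[R]_n) x :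
  pullback G F x = jac F x *m G (F x) *m (jac F x)^T.
Proof.
apply/matrixP => i j; rewrite mxE innerE !mxE; apply: eq_bigr => b _.
rewrite !mxE; congr (_ * _); apply: eq_bigr => a _; by rewrite !mxE.
Qed.

Lemma cov_derivE m n (G : 'rV[R]_n -> 'M[R]_n) (F X : 'rV[R]_m -> 'rV[R]_n)
    (i : 'I_m) (x : 'rV[R]_m) a :
  cov_deriv G F i X x 0 a =
  pderiv i X x 0 a
  + \sum_b \sum_c christoffel G a b c (F x) * pderiv i F x 0 b * X x 0 c.
Proof. exact: mxE. Qed.

(** What [riemannian] and [immersion] say in one pair of charts, [U] and [V] being open sets of
    coordinates. The local computations assume nothing else. *)
Record local_immersion m n (U : set 'rV[R]_m) (V : set 'rV[R]_n)
    (G : 'rV[R]_n -> 'M[R]_n) (F : 'rV[R]_m -> 'rV[R]_n) : Prop := LocalImmersion {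
  li_open_source : open U;
  li_open_target : open V;
  li_maps : forall x, U x -> V (F x);
  li_smooth : smooth_on U F;
  li_metric_smooth : forall i j, smooth_on V (fun y => G y i j);
  li_metric_sym : forall y i j, V y -> G y i j = G y j i;
  li_metric_pos : forall y v, V y -> v != 0 -> 0 < inner (G y) v v;
  li_row_free : forall x, U x -> row_free (jac F x)
}.

Section local.
Variables (m n : nat) (U : set 'rV[R]_m) (V : set 'rV[R]_n).
Variables (G : 'rV[R]_n -> 'M[R]_n) (F : 'rV[R]_m -> 'rV[R]_n).
Hypothesis li : local_immersion U V G F.

Lemma metric_unitmx y : V y -> G y \in unitmx.
Proof. by move=> Vy; apply: posdef_unitmx => v; exact: li_metric_pos li _ _ Vy. Qed.

Lemma pullback_sym x i j : U x -> pullback G F x i j = pullback G F x j i.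
Proof.
move=> /(li_maps li) Vx; rewrite !mxE; apply: inner_sym => a b.
exact: (li_metric_sym li a b Vx).
Qed.

Lemma pullback_pos x v : U x -> v != 0 -> 0 < inner (pullback G F x) v v.
Proof.
move=> Ux v0.
have -> : inner (pullback G F x) v v = inner (G (F x)) (v *m jac F x) (v *m jac F x).
  by rewrite !innerE pullbackE trmx_mul !mulmxA.
apply: (li_metric_pos li); first exact: li_maps li _ Ux.
apply: contraNneq v0 => e; apply/eqP.
by apply: (row_free_inj (li_row_free li Ux)); rewrite e mul0mx.
Qed.

Lemma pullback_unitmx x : U x -> pullback G F x \in unitmx.
Proof. by move=> Ux; apply: posdef_unitmx => v; exact: pullback_pos. Qed.

Lemma pullback_smooth i j : smooth_on U (fun y => pullback G F y i j).
Proof.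
move=> k; have [oU oV] := (li_open_source li, li_open_target li).
have H : Ck_on k U (fun y => \sum_a \sum_b
    ((fun z => G z a b) \o F) y * pderiv i F y 0 a * pderiv j F y 0 b).
  apply: Ck_on_sum => // a; apply: Ck_on_sum => // b.
  apply: Ck_onM => //; first apply: Ck_onM => //.
  - apply: (Ck_on_comp oU oV (li_maps li)); first exact: (li_smooth li).
    exact: (li_metric_smooth li).
  - by apply: Ck_on_coord => //; exact: ((li_smooth li k.+1).2 i).2.
  - by apply: Ck_on_coord => //; exact: ((li_smooth li k.+1).2 j).2.
by apply: Ck_on_ext oU _ H => y Uy; rewrite mxE.
Qed.

Lemma pderiv_immersionC i j x : U x -> pderiv i (pderiv j F) x = pderiv j (pderiv i F) x.
Proof.
move=> Ux; have oU := li_open_source li; apply/rowP => a.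
have dF k y : U y -> derivable F y (delta_mx 0 k).
  by move=> Uy; exact: Ck_on_derivable (li_smooth li 1) Uy.
have dF2 l k : derivable (pderiv k F) x (delta_mx 0 l).
  by apply: (Ck_on_derivable (U := U) (k := 0)) => //; exact: ((li_smooth li 2).2 k).2.
refine (etrans (esym (pderiv_coord a (dF2 i j))) (etrans _ (pderiv_coord a (dF2 j i)))).
transitivity (pderiv i (pderiv j (fun y => F y 0 a)) x).
  by apply: pderiv_open oU Ux _ => y Uy; rewrite pderiv_coord//; exact: dF.
transitivity (pderiv j (pderiv i (fun y => F y 0 a)) x); last first.
  by apply: pderiv_open oU Ux _ => y Uy; rewrite pderiv_coord//; exact: dF.
exact: (schwarz i j oU (Ck_on_coord a oU (li_smooth li 2)) Ux).
Qed.

(** Second partial derivatives commute and the ambient connection is torsion-free; the projection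
    acts on equal vectors. *)
Lemma second_formC i j x : U x -> second_form G F i j x = second_form G F j i x.
Proof.
move=> Ux; rewrite /second_form; apply: (congr1 (normal_proj G F x)).
apply/rowP => a; refine (etrans (cov_derivE _ _ _ _ _ _) (etrans _ (esym (cov_derivE _ _ _ _ _ _)))).
apply: (congr2 +%R).
  by rewrite (pderiv_immersionC i j Ux).
rewrite exchange_big/=; apply: eq_bigr => b _; apply: eq_bigr => c _.
have -> := christoffelC (li_open_target li) (li_metric_sym li) a c b (li_maps li Ux).
exact: mulrAC.
Qed.

End local.
End immersions.

(** * Homogeneity of contractions *)

Section scaling.
Variable R : realType.

Lemma point_R : (point : (R : normedModType R)) = 0. Proof. by []. Qed.
Lemma point_rV n : (point : ('rV[R]_n : normedModType R)) = 0.
Proof. by apply/rowP => i; rewrite !mxE. Qed.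

Lemma pderivZ n (c : R) (f : 'rV[R]_n -> R) i x : c != 0 ->
  pderiv i (fun y => c * f y) x = c * pderiv i f x.
Proof. exact: (@derive_scale R _ _ c f x (delta_mx 0 i) point_R). Qed.

Lemma pderiv_rVZ m n (c : R) (f : 'rV[R]_m -> 'rV[R]_n) i x : c != 0 ->
  pderiv i (fun y => c *: f y) x = c *: pderiv i f x.
Proof. exact: (@derive_scale R _ _ c f x (delta_mx 0 i) (@point_rV n)). Qed.

Lemma invmx_scale n (c : R) (A : 'M[R]_n) : c != 0 -> A \in unitmx ->
  invmx (c *: A) = c^-1 *: invmx A.
Proof. by move=> c0 uA; apply: invmxZ; rewrite unitmxZ// unitfE. Qed.

Section metric_scaling.
Variables (n : nat) (V : set 'rV[R]_n) (g : 'rV[R]_n -> 'M[R]_n) (c : R).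
Hypotheses (oV : open V) (gV : forall y, V y -> g y \in unitmx) (c0 : c != 0).
Let gc := fun y => c *: g y.

Lemma christoffel1_scale k i j y : christoffel1 gc k i j y = c * christoffel1 g k i j y.
Proof.
have e a b d : pderiv a (fun z => gc z b d) y = c * pderiv a (fun z => g z b d) y.
  rewrite -(pderivZ (fun z => g z b d) a y c0); congr (pderiv a _ y).
  by apply/funext => z; rewrite mxE.
have alg (u v w : R) : 2^-1 * (c * u + c * v - c * w) = c * (2^-1 * (u + v - w)) by ring.
rewrite /christoffel1 (e i j k) (e j i k) (e k i j); exact: alg.
Qed.

(** The factor [c] of the first-kind symbols cancels against the one of the inverse metric: a
    constant factor does not affect the connection. *)
Lemma christoffel_scale k i j y : V y -> christoffel gc k i j y = christoffel g k i j y.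
Proof.
move=> Vy; rewrite !christoffelE; apply: eq_bigr => l _.
rewrite (christoffel1_scale l i j y) /gc (invmx_scale c0 (gV Vy)) mxE.
have alg (u v : R) : c^-1 * u * (c * v) = u * v by rewrite mulrACA mulVf// mul1r.
exact: alg.
Qed.

Lemma riemann_scale i j k l y : V y -> riemann gc i j k l y = c * riemann g i j k l y.
Proof.
move=> Vy; rewrite /riemann mulr_sumr; apply: eq_bigr => p _.
rewrite /gc mxE -mulrA; congr (_ * (_ * _)); rewrite -/gc /riemann_up.
have e a b d q : pderiv a (christoffel gc q b d) y = pderiv a (christoffel g q b d) y.
  by apply: pderiv_open oV Vy _ => z; exact: christoffel_scale.
rewrite (e i j l p) (e j i l p); congr (_ + _); apply: eq_bigr => q _.
by rewrite !christoffel_scale.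
Qed.
End metric_scaling.

Section immersion_scaling.
Variables (m n : nat) (U : set 'rV[R]_m) (V : set 'rV[R]_n).
Variables (G : 'rV[R]_n -> 'M[R]_n) (F : 'rV[R]_m -> 'rV[R]_n) (c : R).
Hypotheses (li : local_immersion U V G F) (c0 : c != 0).
Let Gc := fun y => c *: G y.

Lemma pullback_scale x : pullback Gc F x = c *: pullback G F x.
Proof. by apply/matrixP => i j; rewrite !mxE inner_scale. Qed.

Lemma cov_deriv_scale i X x : U x -> cov_deriv Gc F i X x = cov_deriv G F i X x.
Proof.
move=> Ux; apply/rowP => a; refine (etrans (cov_derivE _ _ _ _ _ _) (etrans _ (esym (cov_derivE _ _ _ _ _ _)))).
apply: (congr2 +%R) => //; apply: eq_bigr => b _; apply: eq_bigr => d _.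
have -> // := @christoffel_scale n V G c (@metric_unitmx _ _ _ _ _ _ _ li) c0 a b d (F x) (li_maps li Ux).
Qed.

Lemma normal_proj_scale x v : U x -> normal_proj Gc F x v = normal_proj G F x v.
Proof.
move=> Ux; rewrite /normal_proj; congr (_ - _).
apply: eq_bigr => k _; apply: eq_bigr => l _; congr (_ *: _).
rewrite pullback_scale (invmx_scale c0 (pullback_unitmx li Ux)) mxE inner_scale.
by rewrite mulrACA mulVf// mul1r.
Qed.

Lemma second_form_scale i j x : U x -> second_form Gc F i j x = second_form G F i j x.
Proof.
move=> Ux; rewrite /second_form; apply: etrans (normal_proj_scale _ Ux) _.
exact: (congr1 (normal_proj G F x) (cov_deriv_scale i (pderiv j F) Ux)).
Qed.

Lemma cov_deriv_scaler i X Y x (d : R) : d != 0 -> U x -> (forall y, U y -> X y = d *: Y y) ->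
  cov_deriv G F i X x = d *: cov_deriv G F i Y x.
Proof.
move=> d0 Ux XY; apply/rowP => a; rewrite [RHS]mxE (cov_derivE G F X) (cov_derivE G F Y).
have e : pderiv i X x = d *: pderiv i Y x.
  by rewrite -(pderiv_rVZ Y i x d0); exact: pderiv_open (li_open_source li) Ux XY.
rewrite e mxE mulrDr (XY x Ux); apply: (congr2 +%R) => //.
rewrite mulr_sumr; apply: eq_bigr => b _; rewrite mulr_sumr; apply: eq_bigr => q _.
by rewrite mxE; exact: mulrCA.
Qed.

Lemma normal_projZ x v (d : R) : normal_proj G F x (d *: v) = d *: normal_proj G F x v.
Proof.
rewrite /normal_proj scalerBr scaler_sumr; congr (_ - _).
apply: eq_bigr => k _; rewrite scaler_sumr; apply: eq_bigr => l _.
by rewrite innerZl scalerA; congr (_ *: _); exact: mulrCA.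
Qed.

(** The field is rescaled together with the metric because it will be the unit normal, and then a
    normal derivative of it. Through [derive_scale] neither has to be shown differentiable. *)
Lemma normal_deriv_scale i X Y x (d : R) : d != 0 -> U x -> (forall y, U y -> X y = d *: Y y) ->
  normal_deriv Gc F i X x = d *: normal_deriv G F i Y x.
Proof.
move=> d0 Ux XY; rewrite /normal_deriv (normal_proj_scale _ Ux) (cov_deriv_scale i X Ux).
by rewrite (cov_deriv_scaler i d0 Ux XY) normal_projZ.
Qed.
End immersion_scaling.

Section surface_scaling.
Variables (U : set 'rV[R]_2) (V : set 'rV[R]_3).
Variables (G : 'rV[R]_3 -> 'M[R]_3) (F : 'rV[R]_2 -> 'rV[R]_3) (t : R).
Hypotheses (li : local_immersion U V G F) (t0 : 0 < t).
Let Gt := fun y => t ^+ 2 *: G y.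
Let t2 : t ^+ 2 != 0. Proof. by rewrite expf_neq0// gt_eqF. Qed.
Let tn0 : t != 0. Proof. by rewrite gt_eqF. Qed.

(** The conormal does not involve the metric. Raising its index gives t^-2, so its norm scales by t
    * t^-2 = t^-1, and normalizing leaves t^-2 * t = t^-1. *)
Lemma unit_normal_scale x : U x -> unit_normal Gt F x = t^-1 *: unit_normal G F x.
Proof.
move=> Ux; have uG := metric_unitmx li (li_maps li Ux).
rewrite /unit_normal /Gt (invmx_scale t2 uG) -scalemxAr.
set v := conormal F x *m _; rewrite inner_scale innerZl innerZr scalerA.
have -> : t ^+ 2 * (t ^- 2 * (t ^- 2 * inner (G (F x)) v v)) = t^-1 ^+ 2 * inner (G (F x)) v v.
  by rewrite mulVKf// exprVn.
rewrite sqrtrM ?sqr_ge0// sqrtr_sqr gtr0_norm ?invr_gt0// invfM invrK scalerA.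
by congr (_ *: _); rewrite mulrAC -exprVn expr2 mulrA mulfV// mul1r.
Qed.

Lemma scalar_h_scale i j x : U x -> scalar_h Gt F i j x = t * scalar_h G F i j x.
Proof.
move=> Ux; rewrite /scalar_h (second_form_scale li t2 i j Ux) (unit_normal_scale Ux).
by rewrite /Gt inner_scale innerZr expr2 -mulrA mulVKf.
Qed.

Lemma mean_curvature_scale x : U x -> mean_curvature Gt F x = t^-1 * mean_curvature G F x.
Proof.
move=> Ux; rewrite /mean_curvature mulrCA; congr (_ * _).
rewrite mulr_sumr; apply: eq_bigr => i _; rewrite mulr_sumr; apply: eq_bigr => j _.
rewrite (scalar_h_scale i j Ux) (pullback_scale G F (t ^+ 2) x).
rewrite (invmx_scale t2 (pullback_unitmx li Ux)) mxE mulrACA.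
by rewrite -exprVn expr2 -[_ * _ * t]mulrA mulVf// mulr1.
Qed.

Lemma mean_curvature_metric_scale i j x : U x ->
  mean_curvature Gt F x * pullback Gt F x i j = t * (mean_curvature G F x * pullback G F x i j).
Proof.
move=> Ux; rewrite (mean_curvature_scale Ux) (pullback_scale G F (t ^+ 2) x) mxE mulrACA.
by rewrite expr2 mulKf.
Qed.

Lemma traceless_h_scale i j x : U x -> traceless_h Gt F i j x = t * traceless_h G F i j x.
Proof.
move=> Ux; rewrite /traceless_h (scalar_h_scale i j Ux) (mean_curvature_metric_scale i j Ux).
by rewrite -mulrBr.
Qed.

Lemma normal_curvature_scale i j a b x : U x ->
  normal_curvature Gt F i j a b x = t ^+ 2 * normal_curvature G F i j a b x.
Proof.
move=> Ux; have tV : t^-1 != 0 by rewrite invr_eq0.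
have e k y : U y -> normal_deriv Gt F k (unit_normal Gt F) y =
    t^-1 *: normal_deriv G F k (unit_normal G F) y.
  by move=> Uy; apply: (normal_deriv_scale li t2 k tV Uy) => z; exact: unit_normal_scale.
rewrite /normal_curvature.
rewrite (normal_deriv_scale li t2 i tV Ux (e j)) (normal_deriv_scale li t2 j tV Ux (e i)).
rewrite (unit_normal_scale Ux) /Gt -scalerBr.
move: (unit_normal G F x) => nu; set W := (_ - _ : 'rV[R]_3); move: {e}W => W.
rewrite -!scalemxAl -!scalemxAr !scalerA expr2 mulKf// !mxE.
exact: mulrACA.
Qed.

(** The power of [t] multiplying the covariant components. It is also half the number of index
    slots, so that the inverse metrics of a contraction contribute exactly twice the opposite
    power. *)
Definition factor_weight I J (T : Defs.factor I J) : nat :=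
  match T with Riem _ _ _ _ | NormalCurv _ _ _ _ => 2
  | TracelessH _ _ | MeanCurvMetric _ _ => 1 end.

Lemma factor_component_scale x I J (s : I -> 'I_2) (r : J -> 'I_3) (T : Defs.factor I J) : U x ->
  factor_component Gt F x s r T = t ^+ factor_weight T * factor_component G F x s r T.
Proof.
move=> Ux; case: T => [i j k l|i j a b|i j|i j] /=.
- have -> : pullback Gt F = (fun y => t ^+ 2 *: pullback G F y).
    by apply/funext => y; exact: pullback_scale.
  by apply: (riemann_scale (li_open_source li) _ t2 _ _ _ _ Ux) => y; exact: (pullback_unitmx li).
- exact: normal_curvature_scale.
- exact: traceless_h_scale.
- exact: mean_curvature_metric_scale.
Qed.

Lemma contraction_value_scale (C : complete_contraction) x : U x ->
  contraction_value C Gt F x =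
  t ^+ (\sum_(T <- factors C) factor_weight T) * (t ^- 2) ^+ (tpairs C + apairs C)
  * contraction_value C G F x.
Proof.
move=> Ux; rewrite /contraction_value mulr_sumr; apply: eq_bigr => s _.
rewrite mulr_sumr; apply: eq_bigr => r _.
rewrite (eq_bigr (fun p : 'I__ => t ^- 2 * invmx (pullback G F x) (s (p, false)) (s (p, true)))); last first.
  by move=> p _; rewrite (pullback_scale G F (t ^+ 2) x) (invmx_scale t2 (pullback_unitmx li Ux)) mxE.
rewrite [X in _ * X * _](eq_bigr (fun q : 'I__ => t ^- 2 * invmx (G (F x)) (r (q, false)) (r (q, true)))); last first.
  by move=> q _; rewrite (invmx_scale t2 (metric_unitmx li (li_maps li Ux))) mxE.
rewrite (eq_bigr (fun T => t ^+ factor_weight T * factor_component G F x s r T)); last first.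
  by move=> T _; exact: factor_component_scale.
rewrite !big_split/= !prodr_const !card_ord prodrXr exprD.
set a := t ^+ _; set b := _ ^+ tpairs C; set d := _ ^+ apairs C.
set u := \prod_(_ < _) _; set v := \prod_(_ < _) _; set w := \prod_(_ <- _) _.
by ring.
Qed.
End surface_scaling.
End scaling.

(** * Contractions of weight -2 *)

Section contractions.
Variable R : realType.
Implicit Types (gi h : 'I_2 -> 'I_2 -> R) (T : 'I_2 -> 'I_2 -> 'I_2 -> 'I_2 -> R).

Local Notation o0 := (ord0 : 'I_2).
Local Notation o1 := (ord_max : 'I_2).

Lemma ord2P (i : 'I_2) : i = o0 \/ i = o1.
Proof. by case: i => [[|[|//]] Hi]; [left|right]; exact: val_inj. Qed.

Lemma sum_ord2 (f : 'I_2 -> R) : \sum_i f i = f o0 + f o1.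
Proof. by rewrite big_ord_recl big_ord1; congr (_ + f _); exact: val_inj. Qed.

(** The three ways of pairing four slots, named after the first slot and its partner. *)
Definition contr12 gi T := \sum_u \sum_v \sum_w \sum_z gi u v * gi w z * T u v w z.
Definition contr13 gi T := \sum_u \sum_v \sum_w \sum_z gi u w * gi v z * T u v w z.
Definition contr14 gi T := \sum_u \sum_v \sum_w \sum_z gi u z * gi v w * T u v w z.

Lemma sum_ffun_quadruple (Phi : {ffun 'I_2 * bool -> 'I_2} -> R) :
  \sum_s Phi s = \sum_u \sum_v \sum_w \sum_z
    Phi [ffun pb => if pb.1 == o0 then (if pb.2 then v else u) else if pb.2 then z else w].
Proof.
rewrite pair_bigA /= pair_bigA /= pair_bigA /=.
pose mk (q : 'I_2 * 'I_2 * 'I_2 * 'I_2) : {ffun 'I_2 * bool -> 'I_2} :=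
  [ffun pb => if pb.1 == o0 then (if pb.2 then q.1.1.2 else q.1.1.1)
              else if pb.2 then q.2 else q.1.2].
rewrite (reindex mk) //=.
exists (fun s => (s (o0, false), s (o0, true), s (o1, false), s (o1, true))).
  by case=> [[[u v] w] z] _; rewrite !ffunE.
move=> s _; apply/ffunP => -[p b]; rewrite !ffunE /=.
by case: (ord2P p) => ->; case: b.
Qed.

Definition pairing gi (s : {ffun 'I_2 * bool -> 'I_2}) :=
  \prod_p gi (s (p, false)) (s (p, true)).

Definition slot_sum (i j k l : 'I_2 * bool) gi T :=
  \sum_(s : {ffun 'I_2 * bool -> 'I_2}) pairing gi s * T (s i) (s j) (s k) (s l).

(* Only the partner of the first slot matters; [T] and [gi] are quantified inside
   so that the same alternative holds for all geometries. *)
Lemma slot_sumP (i j k l : 'I_2 * bool) : uniq [:: i; j; k; l] ->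
  [\/ forall gi T, (forall u v, gi u v = gi v u) -> slot_sum i j k l gi T = contr12 gi T,
      forall gi T, (forall u v, gi u v = gi v u) -> slot_sum i j k l gi T = contr13 gi T |
      forall gi T, (forall u v, gi u v = gi v u) -> slot_sum i j k l gi T = contr14 gi T].
Proof.
have E i' j' k' l' gi T : slot_sum i' j' k' l' gi T =
   let val u v w z (p : 'I_2 * bool) := if p.1 == o0 then (if p.2 then v else u) else if p.2 then z else w in
   \sum_u \sum_v \sum_w \sum_z gi u v * gi w z *
     T (val u v w z i') (val u v w z j') (val u v w z k') (val u v w z l').
  rewrite /slot_sum sum_ffun_quadruple; apply: eq_bigr => u _; apply: eq_bigr => v _.
  apply: eq_bigr => w _; apply: eq_bigr => z _; rewrite /pairing.
  have -> (f : 'I_2 -> R) : \prod_p f p = f o0 * f o1.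
    by rewrite big_ord_recl big_ord1; congr (_ * f _); exact: val_inj.
  by rewrite !ffunE.
case: i => p a; case: j => q b; case: k => r c; case: l => s d.
case: (ord2P p) => ->; case: (ord2P q) => ->; case: (ord2P r) => ->; case: (ord2P s) => ->;
case: a => //; case: b => //; case: c => //; case: d => // _;
(* Of the 256 choices of four slots the 24 injective ones are left; each gives one of the three sums
   after expansion, using the symmetry of [gi]. *)
first [ constructor 1; by move=> gi T gs; rewrite E /contr12 !sum_ord2 /= ?(gs o1 o0); ring
| constructor 2; by move=> gi T gs; rewrite E /contr13 !sum_ord2 /= ?(gs o1 o0); ring
| constructor 3; by move=> gi T gs; rewrite E /contr14 !sum_ord2 /= ?(gs o1 o0); ring].
Qed.

(* This kills a lone normal curvature factor without computing it: its two
   tangential slots can only be paired with each other. *)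
Lemma sum_pair_antisym gi (A : 'I_2 -> 'I_2 -> R) (i j : 'I_1 * bool) :
  (forall u v, gi u v = gi v u) -> (forall u v, A u v = - A v u) -> i != j ->
  \sum_(s : {ffun 'I_1 * bool -> 'I_2})
     (\prod_p gi (s (p, false)) (s (p, true))) * A (s i) (s j) = 0.
Proof.
move=> gs As ij.
(* The two distinct slots are the two ends of the only pair. Exchanging the ends preserves the
   metric factor and reverses the sign of [A]. *)
have sw (p : 'I_1 * bool) : (p.1, ~~ p.2) = if p == i then j else i.
  by case: i j p ij => i a [j b] [p c]; rewrite (ord1 i) (ord1 j) (ord1 p); case: a; case: b; case: c.
pose w (s : {ffun 'I_1 * bool -> 'I_2}) : {ffun 'I_1 * bool -> 'I_2} := [ffun p => s (p.1, ~~ p.2)].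
have wK : involutive w by move=> s; apply/ffunP => -[p b]; rewrite !ffunE /= negbK.
set S := \sum_(_ | _) _.
have : S = - S.
  rewrite {1}/S (reindex_inj (inv_inj wK)) /= -sumrN; apply: eq_bigr => s _.
  rewrite !ffunE !sw eqxx eq_sym (negbTE ij) [A (s j) _]As mulrN; congr (- (_ * _)).
  by apply: eq_bigr => p _; rewrite !ffunE /= gs.
by move/eqP; rewrite -subr_eq0 opprK -mulr2n mulrn_eq0 /= => /eqP.
Qed.

End contractions.

Section surface_tensors.
Variable R : realType.
Local Notation o0 := (ord0 : 'I_2).
Local Notation o1 := (ord_max : 'I_2).

Lemma det_ord2 (A : 'M[R]_2) : \det A = A o0 o0 * A o1 o1 - A o0 o1 * A o1 o0.
Proof.
rewrite (expand_det_row _ o0) sum_ord2 /cofactor !det_mx11 !mxE /= expr0 expr1 mul1r mulN1r mulrN.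
by congr (_ * A _ _ - _ * A _ _); exact: val_inj.
Qed.

Variable gi : 'I_2 -> 'I_2 -> R.
Hypothesis gis : forall u v, gi u v = gi v u.
Implicit Types a b g : 'I_2 -> 'I_2 -> R.
Definition trace_with a := \sum_u \sum_v gi u v * a u v.

Lemma contr12_tensor a b :
  contr12 gi (fun u v w z => a u v * b w z) = trace_with a * trace_with b.
Proof. by rewrite /contr12 /trace_with !sum_ord2 /=; ring. Qed.

Lemma contr13_tensorC a b :
  contr13 gi (fun u v w z => a u v * b w z) = contr13 gi (fun u v w z => b u v * a w z).
Proof. by rewrite /contr13 !sum_ord2 /= (gis o1 o0); ring. Qed.

Lemma contr14_tensor a b : (forall u v, b u v = b v u) ->
  contr14 gi (fun u v w z => a u v * b w z) = contr13 gi (fun u v w z => a u v * b w z).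
Proof. by move=> bs; rewrite /contr13 /contr14 !sum_ord2 /= (bs o1 o0); ring. Qed.

Lemma trace_withZ (c : R) a : trace_with (fun u v => c * a u v) = c * trace_with a.
Proof.
rewrite /trace_with mulr_sumr; apply: eq_bigr => u _; rewrite mulr_sumr.
by apply: eq_bigr => v _; rewrite mulrCA.
Qed.

(** One inverse metric cancels against [g], and the other one takes the trace of [a]. *)
Lemma contr13_metric g a (c : R) :
  (forall u v, \sum_w gi u w * g w v = (u == v)%:R) ->
  contr13 gi (fun u v w z => a u v * (c * g w z)) = c * trace_with a.
Proof.
move=> giE; rewrite /contr13 /trace_with mulr_sumr; apply: eq_bigr => u _.
rewrite mulr_sumr; apply: eq_bigr => v _.
rewrite exchange_big /=.
transitivity (c * a u v * \sum_z gi v z * \sum_w gi u w * g w z).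
  rewrite mulr_sumr; apply: eq_bigr => z _; rewrite !mulr_sumr; apply: eq_bigr => w _.
  by ring.
under eq_bigr => z _ do rewrite giE.
rewrite (bigD1 u) //= eqxx mulr1 big1 ?addr0; last first.
  by move=> z; rewrite eq_sym => /negbTE ->; rewrite mulr0.
by rewrite (gis v u) -mulrA [a u v * _]mulrC.
Qed.

Section curvature_tensor.
Variable T : 'I_2 -> 'I_2 -> 'I_2 -> 'I_2 -> R.
Hypotheses (T1 : forall u v w z, T u v w z = - T v u w z).
Hypotheses (T2 : forall u v w z, T u v w z = - T u v z w).

Let opp_self (c : R) : c = - c -> c = 0.
Proof. by move=> /eqP; rewrite -subr_eq0 opprK -mulr2n mulrn_eq0 /= => /eqP. Qed.
Let T1d u w z : T u u w z = 0. Proof. exact: opp_self (T1 u u w z). Qed.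
Let T2d u v w : T u v w w = 0. Proof. exact: opp_self (T2 u v w w). Qed.
Let TE := (T1d, T2d, T1 o1 o0, T2 o0 o1 o1 o0).

Lemma contr12_curvature : contr12 gi T = 0.
Proof. by rewrite /contr12 !sum_ord2 /= !TE (gis o1 o0); ring. Qed.

(** In two dimensions the antisymmetries leave a single independent component; the coefficient in
    front of it is twice the determinant of [gi]. *)
Lemma contr13_curvature :
  contr13 gi T = 2 * ((gi o0 o0 * gi o1 o1 - gi o0 o1 * gi o1 o0) * T o0 o1 o0 o1).
Proof. by rewrite /contr13 !sum_ord2 /= !TE (gis o1 o0); ring. Qed.

Lemma contr14_curvature : contr14 gi T = - contr13 gi T.
Proof. by rewrite contr13_curvature /contr14 !sum_ord2 /= !TE (gis o1 o0); ring. Qed.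
End curvature_tensor.
End surface_tensors.

Section surface_geometry.
Variable R : realType.
Variables (U : set 'rV[R]_2) (V : set 'rV[R]_3).
Variables (G : 'rV[R]_3 -> 'M[R]_3) (F : 'rV[R]_2 -> 'rV[R]_3) (x : 'rV[R]_2).
Hypotheses (li : local_immersion U V G F) (Ux : U x).
Let g := pullback G F x.
Let gi := invmx g.
Let h i j := traceless_h G F i j x.
Let H := mean_curvature G F x.

Lemma inverse_metric_sym u v : gi u v = gi v u.
Proof.
have e : g^T = g by apply/matrixP => a b; rewrite mxE; exact: (pullback_sym li b a Ux).
by rewrite /gi -{1}e -trmx_inv mxE.
Qed.

Lemma inverse_metricE u v : \sum_w gi u w * g w v = (u == v)%:R.
Proof.
have := mulVmx (pullback_unitmx li Ux); rewrite -/g -/gi => /matrixP /(_ u v).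
by rewrite !mxE.
Qed.

Lemma trace_metric : trace_with gi g = 2.
Proof.
rewrite /trace_with; under eq_bigr => u _.
  under eq_bigr => v _ do rewrite [g u v](pullback_sym li u v Ux) -/g.
  rewrite inverse_metricE eqxx; over.
by rewrite sumr_const card_ord.
Qed.

Lemma traceless_h_sym u v : h u v = h v u.
Proof.
rewrite /h /traceless_h /scalar_h (second_formC li u v Ux).
by rewrite (pullback_sym li u v Ux).
Qed.

(** The trace 2 of the metric compensates the factor 1/2 in the mean curvature. *)
Lemma trace_traceless_h : trace_with gi h = 0.
Proof.
have -> : trace_with gi h = trace_with gi (fun u v => scalar_h G F u v x)
   - trace_with gi (fun u v => H * g u v).
  rewrite /trace_with -sumrB; apply: eq_bigr => u _; rewrite -sumrB; apply: eq_bigr => v _.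
  by rewrite -mulrBr.
rewrite trace_withZ trace_metric /H /mean_curvature -/g -/gi -/(trace_with gi _).
by rewrite mulrC mulrA mulfV ?mul1r ?subrr// pnatr_eq0.
Qed.

Lemma traceless_h_sqnormE : traceless_h_sqnorm G F x =
  contr13 gi (fun u v w z => h u v * h w z).
Proof.
rewrite /traceless_h_sqnorm /contr13; apply: eq_bigr => u _; apply: eq_bigr => v _.
by apply: eq_bigr => w _; apply: eq_bigr => z _; rewrite -/g -/gi -/(h u v) -/(h w z) mulrA.
Qed.

Lemma riemann_pullback_antisym_last i j k l :
  riemann (pullback G F) i j k l x = - riemann (pullback G F) i j l k x.
Proof.
apply: (riemann_antisym_last (li_open_source li) _ _ _ i j k l Ux).
- move=> a b; exact: (pullback_smooth li a b 2).
- move=> y a b Uy; exact: (pullback_sym li a b Uy).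
- move=> y Uy; exact: (pullback_unitmx li Uy).
Qed.

(** With the sign convention of [riemann] this contraction is the scalar curvature. *)
Lemma gauss_curvatureE :
  contr13 gi (fun u v w z => riemann (pullback G F) u v w z x) =
  2 * gauss_curvature (pullback G F) x.
Proof.
rewrite contr13_curvature.
- rewrite -det_ord2 /gi det_inv /gauss_curvature; congr (_ * _).
  by rewrite mulrC.
- exact: inverse_metric_sym.
- by move=> u v w z; exact: riemann_antisym_first.
- by move=> u v w z; exact: riemann_pullback_antisym_last.
Qed.
End surface_geometry.

Section contraction_forms.
Variable R : realType.

(** The coefficients are fixed before the geometry: this is what makes them universal. *)
Definition curvature_form (C : complete_contraction) (a b c : R) :=
  forall (U : set 'rV[R]_2) (V : set 'rV[R]_3) (G : 'rV[R]_3 -> 'M[R]_3)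
    (F : 'rV[R]_2 -> 'rV[R]_3) (x : 'rV[R]_2), local_immersion U V G F -> U x ->
  contraction_value C G F x = a * gauss_curvature (pullback G F) x
    + b * traceless_h_sqnorm G F x + c * mean_curvature G F x ^+ 2.

Lemma size_tangential_slots I J (T : Defs.factor I J) :
  (size (tangential_slots T) + size (ambient_slots T) = 2 * factor_weight T)%N.
Proof. by case: T. Qed.

Lemma size_flatten_slots (I J : Type) (f : J -> seq I) (s : seq J) :
  size (flatten [seq f T | T <- s]) = \sum_(T <- s) size (f T) :> nat.
Proof. by elim: s => [|T s IH]; rewrite ?big_nil// big_cons /= size_cat IH. Qed.

(** Slots are counted twice: two for each pair, and twice the weight for each factor. *)
Lemma pairs_weight (C : complete_contraction) :
  (tpairs C + apairs C = \sum_(T <- factors C) factor_weight T)%N.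
Proof.
have e1 := perm_size (tangential_slotsP C); have e2 := perm_size (ambient_slotsP C).
apply/eqP; rewrite -(eqn_pmul2l (isT : 0 < 2)%N) big_distrr /=; apply/eqP.
under [RHS]eq_bigr do rewrite -size_tangential_slots.
rewrite big_split /=; refine (etrans _ (congr2 addn (size_flatten_slots _ _) (size_flatten_slots _ _))).
by rewrite e1 e2 -!cardE !card_prod !card_ord card_bool mulnC mulnDl.
Qed.

Lemma contraction_value_weight (C : complete_contraction) U V G F (x : 'rV[R]_2) (t : R) :
  local_immersion U V G F -> 0 < t -> U x ->
  contraction_value C (fun y => t ^+ 2 *: G y) F x =
  t ^- (\sum_(T <- factors C) factor_weight T) * contraction_value C G F x.
Proof.
move=> li t0 Ux; rewrite (contraction_value_scale li t0 C Ux) pairs_weight.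
set w := \sum_(_ <- _) _; congr (_ * _).
have tn0 : t ^+ w != 0 by rewrite expf_neq0// gt_eqF.
by rewrite exprVn -exprM mul2n -addnn exprD invfM mulrA mulfV// mul1r.
Qed.

(** Without ambient slots there is exactly one assignment [t], and the inner sum has one term. *)
Lemma contraction_no_ambient (p : nat) (fs : seq (Defs.factor ('I_p * bool) ('I_0 * bool))) P Q
    (gi : 'I_2 -> 'I_2 -> R) G F (x : 'rV[R]_2) (T : ('I_p * bool -> 'I_2) -> R) :
  (forall u v, gi u v = invmx (pullback G F x) u v) ->
  (forall s t, \prod_(f <- fs) factor_component G F x s t f = T s) ->
  contraction_value (@CompleteContraction p 0 fs P Q) G F x =
  \sum_(s : {ffun 'I_p * bool -> 'I_2}) (\prod_q gi (s (q, false)) (s (q, true))) * T s.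
Proof.
move=> gE TE; rewrite /contraction_value /=; apply: eq_bigr => s _.
transitivity (\sum_(t : {ffun 'I_0 * bool -> 'I_3}) (\prod_q gi (s (q, false)) (s (q, true))) * T s).
  apply: eq_bigr => t _; rewrite TE big_ord0 mulr1; congr (_ * _).
  by apply: eq_bigr => q _; rewrite gE.
by rewrite sumr_const card_ffun card_prod !card_ord expn0.
Qed.

(** One triple of coefficients is supplied for each possible pairing; [slot_sumP] decides which of
    them is used. *)
Lemma contraction_quadruple (i j k l : 'I_2 * bool) fs P Q
    (T : ('rV[R]_3 -> 'M[R]_3) -> ('rV[R]_2 -> 'rV[R]_3) -> 'rV[R]_2 ->
         'I_2 -> 'I_2 -> 'I_2 -> 'I_2 -> R) (a12 b12 c12 a13 b13 c13 a14 b14 c14 : R) :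
  uniq [:: i; j; k; l] ->
  (forall G F x s (t : 'I_0 * bool -> 'I_3),
     \prod_(f <- fs) factor_component G F x s t f = T G F x (s i) (s j) (s k) (s l)) ->
  (forall U V G F x, local_immersion U V G F -> U x ->
     let gi := invmx (pullback G F x) in
     let K := gauss_curvature (pullback G F) x in
     let h2 := traceless_h_sqnorm G F x in
     let H := mean_curvature G F x in
     [/\ contr12 gi (T G F x) = a12 * K + b12 * h2 + c12 * H ^+ 2,
         contr13 gi (T G F x) = a13 * K + b13 * h2 + c13 * H ^+ 2 &
         contr14 gi (T G F x) = a14 * K + b14 * h2 + c14 * H ^+ 2]) ->
  exists a b c, curvature_form (@CompleteContraction 2 0 fs P Q) a b c.
Proof.
move=> u TE TK.
have E U V G F x : local_immersion U V G F -> U x ->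
    contraction_value (@CompleteContraction 2 0 fs P Q) G F x =
    slot_sum i j k l (invmx (pullback G F x)) (T G F x).
  move=> li Ux.
  apply: (@contraction_no_ambient 2 fs P Q (fun u v => invmx (pullback G F x) u v) G F x
    (fun s => T G F x (s i) (s j) (s k) (s l))) => // s t; exact: TE.
case: (slot_sumP R u) => S; [exists a12, b12, c12|exists a13, b13, c13|exists a14, b14, c14];
  move=> U V G F x li Ux; rewrite (E U V)// S; try exact: (inverse_metric_sym li Ux);
  by have [] := TK U V G F x li Ux.
Qed.

Lemma contraction_of_weight2 (C : complete_contraction) :
  (\sum_(T <- factors C) factor_weight T = 2)%N ->
  exists a b c, curvature_form C a b c.
Proof.
have := pairs_weight C; case: C => p q fs P Q /= pq w2.
have sz : (\sum_(T <- fs) size (tangential_slots T) = p * 2)%N.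
  refine (etrans (esym (size_flatten_slots _ _)) _).
  by rewrite (perm_size P) -cardE card_prod card_ord card_bool.
have uP : uniq (flatten [seq tangential_slots T | T <- fs]).
  by rewrite (perm_uniq P) enum_uniq.
rewrite w2 in pq.
case: fs P Q w2 sz uP => [|T1 [|T2 [|T3 fs]]] P Q; rewrite ?big_nil// !big_cons ?big_nil ?addn0.
- case: T1 P Q => [i j k l|i j a b|//|//] P Q _ /= sz uP.
  + have e : p = 2%N by case: p {i j k l P Q uP pq} sz => [|[|[|p]]]//.
    subst p; have {pq}e : q = 0%N by case: q pq {P Q}.
    subst q.
    (* The coefficients of K by partner of the first slot: 0 by antisymmetry, then 2 and -2 for the
       scalar curvature and its opposite. *)
    apply: (@contraction_quadruple i j k l _ P Q
      (fun G F x u v w z => riemann (pullback G F) u v w z x) 0 0 0 2 0 0 (-2) 0 0) => //.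
      by move=> G F x s t; rewrite big_cons big_nil mulr1.
    move=> U V G F x li Ux gi K h2 H.
    have gis : forall u v, gi u v = gi v u := inverse_metric_sym li Ux.
    have a1 u v w z : riemann (pullback G F) u v w z x = - riemann (pullback G F) v u w z x.
      exact: riemann_antisym_first.
    have a2 u v w z := riemann_pullback_antisym_last li Ux u v w z.
    rewrite (contr14_curvature gis a1 a2) (gauss_curvatureE li Ux) (contr12_curvature gis a1 a2).
    by split; rewrite /K; ring.
  (* With the ambient indices summed outside, they and their inverse metrics are constants for the
     tangential sum, which vanishes by antisymmetry. *)
  + have e : p = 1%N by case: p {i j P Q uP pq a b} sz => [|[|p]]//.
    subst p; exists 0, 0, 0 => U V G F x li Ux.
    rewrite !mul0r !addr0 /contraction_value /= exchange_big /=; apply: big1 => t _.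
    under eq_bigr => s _ do rewrite big_cons big_nil mulr1 /= mulrAC -mulrA.
    set d := \prod_(_ < _) _.
    apply: (sum_pair_antisym (gi := invmx (pullback G F x))
      (A := fun u v => normal_curvature G F u v (t a) (t b) x * d)).
    * exact: (inverse_metric_sym li Ux).
    * move=> u v; rewrite -mulNr; congr (_ * _).
      rewrite /normal_curvature -mulNr; congr (_ * _).
      by rewrite -[in LHS]opprB mulNmx mxE.
    * by move: uP; rewrite /= inE => /andP[].
- case: T1 P Q => [i j k l|i j a b|i j|i j] P Q; case: T2 P Q => [i' j' k' l'|i' j' a' b'|i' j'|i' j'] P Q //= _ sz uP;
    (have e : p = 2%N by case: p {i j i' j' P Q uP pq} sz => [|[|[|p]]]//);
    subst p; (have {pq}e : q = 0%N by case: q pq {P Q}); subst q.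
  + apply: (contraction_quadruple P Q (T := fun G F x u v w z => traceless_h G F u v x * traceless_h G F w z x)
      (a12 := 0) (b12 := 0) (c12 := 0) (a13 := 0) (b13 := 1) (c13 := 0)
      (a14 := 0) (b14 := 1) (c14 := 0) uP) => [G F x s t|U V G F x li Ux gi K h2 H].
      by rewrite !big_cons big_nil mulr1.
    have gis : forall u v, gi u v = gi v u := inverse_metric_sym li Ux.
    have hs := traceless_h_sym li Ux.
    rewrite contr12_tensor (contr14_tensor _ _ hs) (trace_traceless_h li Ux) -traceless_h_sqnormE.
    by rewrite -/h2; split; ring.
  (* Contracted with a multiple of the metric, the traceless form always produces its trace, 0. *)
  + apply: (contraction_quadruple P Q (T := fun G F x u v w z => traceless_h G F u v x *
      (mean_curvature G F x * pullback G F x w z))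
      (a12 := 0) (b12 := 0) (c12 := 0) (a13 := 0) (b13 := 0) (c13 := 0)
      (a14 := 0) (b14 := 0) (c14 := 0) uP) => [G F x s t|U V G F x li Ux gi K h2 H].
      by rewrite !big_cons big_nil mulr1.
    have gis : forall u v, gi u v = gi v u := inverse_metric_sym li Ux.
    have ms u v : H * pullback G F x u v = H * pullback G F x v u by rewrite (pullback_sym li u v Ux).
    rewrite contr12_tensor (contr14_tensor _ _ ms) (trace_traceless_h li Ux).
    rewrite (contr13_metric gis _ _ (inverse_metricE li Ux)) (trace_traceless_h li Ux).
    by split; ring.
  + apply: (contraction_quadruple P Q (T := fun G F x u v w z =>
      mean_curvature G F x * pullback G F x u v * traceless_h G F w z x)
      (a12 := 0) (b12 := 0) (c12 := 0) (a13 := 0) (b13 := 0) (c13 := 0)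
      (a14 := 0) (b14 := 0) (c14 := 0) uP) => [G F x s t|U V G F x li Ux gi K h2 H].
      by rewrite !big_cons big_nil mulr1.
    have gis : forall u v, gi u v = gi v u := inverse_metric_sym li Ux.
    rewrite contr12_tensor (contr14_tensor _ _ (traceless_h_sym li Ux)) (trace_traceless_h li Ux).
    rewrite (contr13_tensorC gis) (contr13_metric gis _ _ (inverse_metricE li Ux)) (trace_traceless_h li Ux).
    by split; ring.
  (* The product of two traces of g is 2 * 2 = 4, and the squared norm of g is 2. *)
  + apply: (contraction_quadruple P Q (T := fun G F x u v w z =>
      mean_curvature G F x * pullback G F x u v * (mean_curvature G F x * pullback G F x w z))
      (a12 := 0) (b12 := 0) (c12 := 4) (a13 := 0) (b13 := 0) (c13 := 2)
      (a14 := 0) (b14 := 0) (c14 := 2) uP) => [G F x s t|U V G F x li Ux gi K h2 H].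
      by rewrite !big_cons big_nil mulr1.
    have gis : forall u v, gi u v = gi v u := inverse_metric_sym li Ux.
    have ms u v : H * pullback G F x u v = H * pullback G F x v u by rewrite (pullback_sym li u v Ux).
    rewrite contr12_tensor (contr14_tensor _ _ ms) trace_withZ (trace_metric li Ux).
    rewrite (contr13_metric gis _ _ (inverse_metricE li Ux)) trace_withZ (trace_metric li Ux).
    by rewrite -/H; split; ring.
(* Three or more factors would have total weight at least 3. *)
- have W I J (T : Defs.factor I J) : (0 < factor_weight T)%N by case: T.
  move=> w2; exfalso; move: w2 (W _ _ T1) (W _ _ T2) (W _ _ T3).
  case: (factor_weight T1) => [|a]//; case: (factor_weight T2) => [|b]//.
  by case: (factor_weight T3) => [|c]//; rewrite !addSn !addnS.
Qed.
End contraction_forms.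

(** * From coordinates to immersed surfaces *)

Section immersed_surfaces.
Variable R : realType.

(** Near a point of the open chart image this set is the preimage of [A] under the continuous
    inverse chart. *)
Lemma chart_image_open n (M : topologicalType) (c : chart R n M) (A : set M) :
  open A -> open (cmap c @` (cdom c `&` A)).
Proof.
move=> oA; rewrite openE => _ [p [cp Ap] <-].
have ip : (cmap c @` cdom c) (cmap c p) by exists p.
have n1 : nbhs (cmap c p) (cmap c @` cdom c).
  by apply: open_nbhs_nbhs; split => //; exact: cimage_open.
have n2 : nbhs (cmap c p) (cinv c @^-1` A).
  by apply: (cinv_continuous ip); rewrite cmapK//; apply: open_nbhs_nbhs.
apply: filterS2 n1 n2 => _ [q cq <-]; rewrite /= cmapK// => Aq.
by exists q.
Qed.

Lemma overlap_open n (M : topologicalType) (c c' : chart R n M) : open (overlap c c').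
Proof. by apply: chart_image_open; exact: cdom_open. Qed.

Lemma immersion_domain_open m n (M : manifold R m) (N : manifold R n) (f : M -> N)
    (c : chart R m M) (c' : chart R n N) :
  continuous f -> open (cmap c @` (cdom c `&` f @^-1` cdom c')).
Proof.
move=> cf; apply: chart_image_open; apply: open_comp; last exact: cdom_open.
by move=> p _; exact: cf.
Qed.

Lemma chart_local_immersion m n (M : manifold R m) (N : manifold R n) (G : metric N) (f : M -> N)
    (c : chart R m M) (c' : chart R n N) :
  riemannian G -> immersion f -> atlas c -> atlas c' ->
  local_immersion (cmap c @` (cdom c `&` f @^-1` cdom c')) (cmap c' @` cdom c')
    (G c') (local_rep f c c').
Proof.
move=> [Gs Gsym Gpos _] [cf fi] ac ac'; have [Fs Ff] := fi c c' ac ac'.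
split => //.
- exact: immersion_domain_open.
- exact: cimage_open.
- by move=> _ [p [cp fp] <-]; rewrite /local_rep cmapK//; exists (f p).
- by move=> i j; exact: Gs.
- by move=> y i j; exact: Gsym.
- by move=> y v; exact: Gpos.
Qed.

(** Stated for manifolds, unlike [curvature_form]: contractions of the wrong homogeneity vanish
    because of [has_weight], which speaks of manifolds only. *)
Definition surface_form (P : geometric_scalar R) (a b c : R) :=
  forall (M : manifold R 2) (N : manifold R 3) (G : metric N) (f : M -> N),
  riemannian G -> immersion f -> forall p ch ch', chart_pair f p ch ch' ->
  scalar_value P (G ch') (local_rep f ch ch') (cmap ch p) =
  a * gauss_curvature (pullback (G ch') (local_rep f ch ch')) (cmap ch p)
  + b * traceless_h_sqnorm (G ch') (local_rep f ch ch') (cmap ch p)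
  + c * mean_curvature (G ch') (local_rep f ch ch') (cmap ch p) ^+ 2.

Lemma contraction_surface_form (C : complete_contraction) :
  has_weight R C (-2) -> exists a b c, surface_form [:: (1, C)] a b c.
Proof.
move=> hC.
have [w2|w2] := eqVneq (\sum_(T <- factors C) factor_weight T)%N 2%N.
  have [a [b [c abc]]] := contraction_of_weight2 R w2; exists a, b, c.
  move=> M N G f rG fi p ch ch' [ac ac' cp fp].
  rewrite /scalar_value big_cons big_nil addr0 mul1r.
  by apply: (abc _ _ _ _ _ (chart_local_immersion rG fi ac ac')); exists p.
exists 0, 0, 0 => M N G f rG fi p ch ch' chp.
have [ac ac' cp fp] := chp.
rewrite /scalar_value big_cons big_nil addr0 mul1r !mul0r !addr0.
(* At t = 2 a contraction of total weight w is multiplied by 2^-w and also by 2^-2. So w = 2,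
   excluded here, or the value is 0. *)
have /(_ 2 (ltr0n _ 2)) := hC M N G f rG fi p ch ch' chp.
have Ux : (cmap ch @` (cdom ch `&` f @^-1` cdom ch')) (cmap ch p) by exists p.
rewrite (contraction_value_weight C (chart_local_immersion rG fi ac ac') (ltr0n _ 2) Ux).
move/eqP; rewrite -subr_eq0 -mulrBl mulf_eq0 subr_eq0 => /orP[|/eqP//].
rewrite (_ : (2 : R) ^ (-2) = 2 ^- 2)// (inj_eq (@invr_inj R)) => /eqP e.
exfalso; move/eqP: w2; apply.
have /eqP := e; rewrite -!natrX eqr_nat => /eqP /(congr1 (logn 2)).
by rewrite !lognX !muln1.
Qed.

Lemma scalar_surface_form (P : geometric_scalar R) :
  (forall l aC, onth P l = Some aC -> has_weight R aC.2 (-2)) ->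
  exists a b c, surface_form P a b c.
Proof.
elim: P => [|[q C] P IH] hP.
  exists 0, 0, 0 => M N G f rG fi p ch ch' chp.
  by rewrite /scalar_value big_nil !mul0r !addr0.
have [a [b [c abc]]] := IH (fun l => hP l.+1).
have [a1 [b1 [c1 abc1]]] := contraction_surface_form (hP 0%N (q, C) erefl).
exists (q * a1 + a), (q * b1 + b), (q * c1 + c) => M N G f rG fi p ch ch' chp.
have e1 := abc1 M N G f rG fi p ch ch' chp.
have e := abc M N G f rG fi p ch ch' chp.
move: e1 e; rewrite /scalar_value !big_cons big_nil /= mul1r addr0 => -> ->.
by ring.
Qed.
End immersed_surfaces.

(** * The flat torus in its product with a line *)

Section slab.
Variable R : realType.

Definition tangent_basis (i : 'I_2) : 'rV[R]_3 := delta_mx 0 (widen_ord (isT : 2 <= 3)%N i).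

(* exp(2 s z) times the flat metric of R^3, z being the last coordinate: the
   flat metric for [s = 0] and its conformal change by [z] for [s = 1]. *)
Definition slab_metric (s : R) (y : 'rV[R]_3) : 'M[R]_3 := expR (2 * (s * y 0 ord_max)) *: 1%:M.

Lemma inner1 n (v w : 'rV[R]_n) : inner 1%:M v w = \sum_a v 0 a * w 0 a.
Proof. by rewrite innerE mulmx1 mxE; apply: eq_bigr => a _; rewrite mxE. Qed.

Lemma inner1_delta n (v : 'rV[R]_n) a : inner 1%:M v (delta_mx 0 a) = v 0 a.
Proof.
rewrite inner1 (bigD1 a) //= mxE !eqxx mulr1 big1 ?addr0// => b ba.
by rewrite mxE (negbTE ba) andbF mulr0.
Qed.

(** Only points with z = 0 matter, since the surface lies there; the exponential is then 1. *)
Lemma pderiv_slab_metric s k i j (y : 'rV[R]_3) : y 0 ord_max = 0 ->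
  pderiv k (fun z => slab_metric s z i j) y = 2 * s * (k == ord_max)%:R * (i == j)%:R.
Proof.
move=> y0.
have dc : derivable (fun z : 'rV[R]_3 => z 0 ord_max) y (delta_mx 0 k).
  by apply: (derivable_mxP _ _ _).1 => //; exact: derivable_id.
have ec : 'D_(delta_mx 0 k) (fun z : 'rV[R]_3 => z 0 ord_max) y = (k == ord_max)%:R.
  have di : derivable (id : 'rV[R]_3 -> 'rV[R]_3) y (delta_mx 0 k) by exact: derivable_id.
  by have := derive_mx di; move=> /matrixP/(_ 0 ord_max); rewrite mxE derive_id mxE eqxx eq_sym /= => <-.
pose u (z : 'rV[R]_3) : R := (2 * s) * z 0 ord_max.
have du : derivable u y (delta_mx 0 k) by exact: derivableM (derivable_cst _ _ _) dc.
have eu : 'D_(delta_mx 0 k) u y = 2 * s * (k == ord_max)%:R.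
  by rewrite -ec; exact: (@deriveZ _ _ _ (fun z : 'rV[R]_3 => z 0 ord_max) (2 * s) y (delta_mx 0 k) dc).
have dE : differentiable (expR : R -> R) (u y) by apply/derivable1_diffP; exact: derivable_expR.
have [d1 e1] := derive_comp du dE.
have e2 : 'D_(delta_mx 0 k) (expR \o u) y = 2 * s * (k == ord_max)%:R.
  rewrite e1 eu -{1}[2 * s * _]mulr1 -[_ * 1]/(_ *: (1 : R)) linearZ/= -deriveE//.
  have [_ ->] : is_derive (u y) 1 (expR : R -> R) (expR (u y)) by exact: is_derive_expR.
  by rewrite /u y0 mulr0 expR0; exact: mulr1.
have e3 : (fun z => slab_metric s z i j) = (fun z => (i == j)%:R * (expR \o u) z).
  by apply/funext => z; rewrite /slab_metric !mxE /u /= mulrC mulrA.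
transitivity ((i == j)%:R * 'D_(delta_mx 0 k) (expR \o u) y); last by rewrite e2 mulrC.
rewrite e3; exact: (@deriveZ _ _ _ (expR \o u) ((i == j)%:R) y (delta_mx 0 k) d1).
Qed.

Lemma slab_metric0 s (y : 'rV[R]_3) : y 0 ord_max = 0 -> slab_metric s y = 1%:M.
Proof. by move=> y0; rewrite /slab_metric y0 !mulr0 expR0 scale1r. Qed.

(** The conformal change of the flat connection by phi = s z: delta^k_j d_i phi + delta^k_i d_j phi
    - delta_ij d_k phi. *)
Lemma christoffel_slab s k i j (y : 'rV[R]_3) : y 0 ord_max = 0 ->
  christoffel (slab_metric s) k i j y =
  s * ((i == ord_max)%:R * (j == k)%:R + (j == ord_max)%:R * (i == k)%:R
       - (k == ord_max)%:R * (i == j)%:R).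
Proof.
move=> y0; rewrite christoffelE (slab_metric0 s y0) invmx1 (bigD1 k) //= mxE eqxx mul1r.
rewrite big1 ?addr0 => [|l lk]; last by rewrite mxE eq_sym (negbTE lk) mul0r.
rewrite /christoffel1 !pderiv_slab_metric//.
by field.
Qed.

Lemma sum_delta2 n (Gam : 'I_n -> 'I_n -> R) p q :
  \sum_b \sum_c Gam b c * (delta_mx 0 p : 'rV[R]_n) 0 b * (delta_mx 0 q : 'rV[R]_n) 0 c = Gam p q.
Proof.
rewrite (bigD1 p)//= [X in _ + X]big1 => [|b bp]; last first.
  by apply: big1 => c _; rewrite mxE (negbTE bp) andbF mulr0 mul0r.
rewrite (bigD1 q)//= [X in _ + X + _]big1 => [|c cq]; last first.
  by rewrite [delta_mx 0 q _ _]mxE (negbTE cq) andbF mulr0.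
by rewrite !mxE !eqxx !mulr1 !addr0.
Qed.

Lemma widen_neq_max (k : 'I_2) : (widen_ord (isT : 2 <= 3)%N k == ord_max) = false.
Proof. by apply/negP => /eqP /(congr1 val) /= e; have := ltn_ord k; rewrite e. Qed.

(** * Extrinsic geometry of the plane z = 0 *)

Section slab_surface.
Variables (U : set 'rV[R]_2) (F : 'rV[R]_2 -> 'rV[R]_3) (s : R).
Hypotheses (oU : open U) (F2 : forall y, U y -> F y 0 ord_max = 0).
Hypothesis (F1 : forall y i, U y -> pderiv i F y = tangent_basis i).
Local Notation E := (slab_metric s).

Lemma slab_pullback y : U y -> pullback E F y = 1%:M.
Proof.
move=> Uy; apply/matrixP => i j; rewrite !mxE (slab_metric0 s (F2 Uy)) !F1//.
by rewrite inner1_delta mxE eqxx eq_sym.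
Qed.

Lemma slab_gauss_curvature y : U y -> gauss_curvature (pullback E F) y = 0.
Proof.
move=> Uy.
have c1 i j l z : U z -> pderiv l (fun u => pullback E F u i j) z = 0 :> R.
  move=> Uz; rewrite -[RHS](derive_cst ((1%:M : 'M[R]_2) i j) z (delta_mx 0 l)).
  by apply: pderiv_open oU Uz _ => u Uu; rewrite slab_pullback.
have c2 k i j z : U z -> christoffel (pullback E F) k i j z = 0.
  move=> Uz; rewrite christoffelE big1// => l _.
  by rewrite /christoffel1 !c1// subr0 addr0 !mulr0.
rewrite /gauss_curvature /riemann big1 ?mul0r// => p _.
have c3 i k l j : pderiv i (christoffel (pullback E F) k l j) y = 0 :> R.
  rewrite -[RHS](derive_cst (0 : R) y (delta_mx 0 i)).
  by apply: pderiv_open oU Uy _ => u Uu; exact: c2.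
rewrite /riemann_up !c3 subrr add0r big1 ?mulr0// => q _.
by rewrite !c2// !mul0r subrr.
Qed.

(** The second derivatives of [F] vanish, and for tangential lower indices only the symbol with
    upper index z survives. The result is already normal, so the projection fixes it. *)
Lemma slab_second_form i j y : U y ->
  second_form E F i j y = - (s * (i == j)%:R) *: delta_mx 0 ord_max.
Proof.
move=> Uy; rewrite /second_form.
have -> : cov_deriv E F i (pderiv j F) y = - (s * (i == j)%:R) *: delta_mx 0 ord_max.
  apply/rowP => a; rewrite cov_derivE.
  have -> : pderiv i (pderiv j F) y = 0.
    rewrite -[RHS](derive_cst (tangent_basis j) y (delta_mx 0 i)).
    by apply: pderiv_open oU Uy _ => z Uz; exact: F1.
  rewrite !F1// mxE add0r sum_delta2 christoffel_slab ?F2// !widen_neq_max !mul0r !add0r.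
  rewrite !mxE eqxx /= mulrN mulNr [(a == _)%:R * _]mulrC mulrA.
  by have -> : (widen_ord (isT : 2 <= 3)%N i == widen_ord (isT : 2 <= 3)%N j) = (i == j) by [].
rewrite /normal_proj big1 ?subr0// => k _; rewrite big1// => l _.
rewrite (slab_metric0 s (F2 Uy)) F1// inner1_delta !mxE widen_neq_max.
by rewrite andbF mulr0 mulr0 scale0r.
Qed.

Lemma slab_conormal y : U y -> conormal F y = delta_mx 0 ord_max.
Proof.
move=> Uy; apply/rowP => a; rewrite mxE.
have J i b : jac F y i b = (b == widen_ord (isT : 2 <= 3)%N i)%:R by rewrite mxE F1// mxE eqxx.
set A := (X in \det X).
have A0 b : A ord0 b = (b == a)%:R.
  rewrite (_ : ord0 = lshift 2 (ord0 : 'I_1)); last exact: val_inj.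
  by rewrite /A col_mxEu mxE eqxx.
have A1 i b : A (lift ord0 i) b = (b == widen_ord (isT : 2 <= 3)%N i)%:R.
  rewrite (_ : lift ord0 i = rshift 1 i); last exact: val_inj.
  by rewrite /A col_mxEd J.
rewrite (expand_det_row _ ord0); under eq_bigr => b _ do rewrite A0.
rewrite (bigD1 a)//= eqxx mul1r big1 ?addr0; last first.
  by move=> b ba; rewrite (negbTE ba) mul0r.
have C (i b : 'I_2) : (row' ord0 (col' a A) : 'M[R]_2) i b = (lift a b == widen_ord (isT : 2 <= 3)%N i)%:R.
  by rewrite mxE mxE A1.
rewrite /cofactor det_ord2 !C mxE eqxx /=.
rewrite -!val_eqE /= /bump add0n.
by case: a {A A0 A1 C} => [[|[|[|//]]] Ha] /=; ring.
Qed.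

Lemma slab_unit_normal y : U y -> unit_normal E F y = delta_mx 0 ord_max.
Proof.
move=> Uy; rewrite /unit_normal slab_conormal// (slab_metric0 s (F2 Uy)) invmx1 mulmx1.
by rewrite inner1_delta mxE !eqxx sqrtr1 invr1 scale1r.
Qed.

Lemma slab_scalar_h i j y : U y -> scalar_h E F i j y = - (s * (i == j)%:R).
Proof.
move=> Uy; rewrite /scalar_h slab_second_form// slab_unit_normal// (slab_metric0 s (F2 Uy)).
by rewrite innerZl inner1_delta mxE !eqxx mulr1.
Qed.

Lemma slab_mean_curvature y : U y -> mean_curvature E F y = - s.
Proof.
move=> Uy; rewrite /mean_curvature slab_pullback// invmx1.
have e i j : (1%:M : 'M[R]_2) i j * scalar_h E F i j y = - s * (i == j)%:R.
  by rewrite slab_scalar_h// mxE; case: (i == j); rewrite !(mulr1, mul1r, mulr0, mul0r, oppr0).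
under eq_bigr => i _ do under eq_bigr => j _ do rewrite e.
by rewrite !sum_ord2 /=; field.
Qed.

Lemma slab_traceless_h_sqnorm y : U y -> traceless_h_sqnorm E F y = 0.
Proof.
move=> Uy; rewrite /traceless_h_sqnorm; do 4 (rewrite big1// => ? _).
rewrite /traceless_h slab_scalar_h// slab_mean_curvature// slab_pullback//.
by rewrite [1%:M _ _]mxE mulNr opprK addNr mulr0 mul0r.
Qed.
End slab_surface.
End slab.

(** * Quotients by translations: topology and charts *)

Section cylinders.
Variable R : realType.
Implicit Type n : nat.

(* For every n the quotient is by the lattice Z^2 x {0} of R^n: the torus for
   n = 2, and its product with a line for n = 3. *)
Definition period n (v : 'rV[R]_n) : bool :=
  [forall i : 'I_n, if (i < 2)%N then v 0 i \is a Num.int else v 0 i == 0].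

Lemma periodP n (v : 'rV[R]_n) :
  reflect (forall i : 'I_n, if (i < 2)%N then (v 0 i \is a Num.int : Prop) else v 0 i = 0) (period v).
Proof.
by apply: (iffP forallP) => H i; have := H i; case: ifP => // _; [move/eqP|move->].
Qed.

Lemma period0 n : period (0 : 'rV[R]_n).
Proof. by apply/periodP => i; rewrite mxE; case: ifP. Qed.

Lemma periodN n (v : 'rV[R]_n) : period v -> period (- v).
Proof.
move=> /periodP pv; apply/periodP => i; rewrite mxE; have := pv i.
by case: ifP => _; [rewrite rpredN|move->; rewrite oppr0].
Qed.

Lemma periodD n (u v : 'rV[R]_n) : period u -> period v -> period (u + v).
Proof.
move=> /periodP pu /periodP pv; apply/periodP => i; rewrite mxE; move: (pu i) (pv i).
by case: ifP => _; [exact: rpredD|move=> -> ->; rewrite addr0].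
Qed.

Definition congruent n : rel 'rV[R]_n := fun x y => period (x - y).

Lemma congruent_refl n : reflexive (@congruent n).
Proof. by move=> x; rewrite /congruent subrr period0. Qed.

Lemma congruent_sym n : symmetric (@congruent n).
Proof.
suff H x y : @congruent n x y -> congruent y x by move=> x y; apply/idP/idP; exact: H.
by rewrite /congruent -opprB => /periodN; rewrite opprK.
Qed.

Lemma congruent_trans n : transitive (@congruent n).
Proof. by move=> y x z xy yz; rewrite /congruent -(subrKA y) periodD. Qed.

Canonical congruent_equiv n :=
  EquivRel (@congruent n) (@congruent_refl n) (@congruent_sym n) (@congruent_trans n).

Definition cylinder n : topologicalType :=
  quotient_topology {eq_quot @congruent n}%qT.

Definition proj n (x : 'rV[R]_n) : cylinder n := (\pi_{eq_quot @congruent n}%qT x)%qT.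
Definition lift_point n (p : cylinder n) : 'rV[R]_n := repr (p : {eq_quot @congruent n}%qT).

Lemma lift_pointK n (p : cylinder n) : proj (lift_point p) = p.
Proof. exact: reprK. Qed.

Lemma proj_eqP n (x y : 'rV[R]_n) : reflect (proj x = proj y) (period (x - y)).
Proof. exact: eqquotP. Qed.

Lemma lift_proj n (x : 'rV[R]_n) : period (x - lift_point (proj x)).
Proof. by apply/proj_eqP; rewrite lift_pointK. Qed.

Lemma projD n (x v : 'rV[R]_n) : period v -> proj (x + v) = proj x.
Proof. by move=> pv; apply/proj_eqP; rewrite addrAC subrr add0r. Qed.

Lemma proj_continuous n : continuous (@proj n).
Proof. exact: pi_continuous. Qed.

Lemma open_cylinder n (A : set (cylinder n)) : open A = open (@proj n @^-1` A).
Proof. by []. Qed.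

Lemma translate_continuous n (v : 'rV[R]_n) : continuous (fun x : 'rV[R]_n => x + v).
Proof.
move=> x; apply: (@cvgD _ 'rV[R]_n _ (nbhs x) _ id (cst v) x v); [exact: cvg_id|exact: cvg_cst].
Qed.

(** The saturation of [A] is the union of its translates by periods. *)
Lemma proj_open n (A : set 'rV[R]_n) : open A -> open (@proj n @` A).
Proof.
move=> oA; rewrite open_cylinder.
have -> : @proj n @^-1` (@proj n @` A) =
    \bigcup_(v in [set v | period v]) ((fun x => x + v) @^-1` A).
  apply/seteqP; split=> [x [y Ay yx]|x [v pv Axv]] /=.
    exists (y - x); first by apply/proj_eqP.
    by rewrite /= addrC subrK.
  by exists (x + v) => //; exact: projD.
apply: bigcup_open => v _; apply: open_comp => // x _; exact: translate_continuous.
Qed.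

(** Side length 1 is the largest for which [proj] is injective on the open box; the directions that
    are not quotiented are left unbounded. *)
Definition box n (a : 'rV[R]_n) : set 'rV[R]_n :=
  [set x | forall i : 'I_n, (i < 2)%N -> a 0 i < x 0 i < a 0 i + 1].

Lemma near_coord n (x : 'rV[R]_n) i (a b : R) :
  a < x 0 i < b -> nbhs x (fun y : 'rV[R]_n => a < y 0 i < b).
Proof.
move=> ab; have nb : nbhs (x 0 i) [set r | a < r < b].
  rewrite -set_itvoo; apply: open_nbhs_nbhs; split; first exact: interval_open.
  by rewrite /= in_itv/=.
exact: (@coord_continuous R 1 n 0 i x _ nb).
Qed.

Lemma open_coords n (Q : pred 'I_n) (a b : 'I_n -> R) :
  open [set x : 'rV[R]_n | forall i, Q i -> a i < x 0 i < b i].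
Proof.
rewrite openE => x ax.
have H : nbhs x (fun y : 'rV[R]_n => forall i, Q i -> a i < y 0 i < b i).
  apply: (@filter_forall 'rV[R]_n 'I_n (fun i (y : 'rV[R]_n) => Q i -> a i < y 0 i < b i) (nbhs (x : 'rV[R]_n)) _) => i; case Qi : (Q i); last first.
    by apply: (@filterE 'rV[R]_n (nbhs (x : 'rV[R]_n)) (nbhs_filter (x : 'rV[R]_n))).
  have := @near_coord n x i (a i) (b i) (ax i Qi).
  move=> nx; exact: (@filterS 'rV[R]_n (nbhs x) (nbhs_filter (x : 'rV[R]_n)) _ _ (fun y H _ => H) nx).
exact: H.
Qed.

Lemma box_open n (a : 'rV[R]_n) : open (box a).
Proof. exact: (@open_coords n (fun i : 'I_n => (i < 2)%N) (fun i => a 0 i) (fun i => a 0 i + 1)). Qed.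

(** The representative of [x] in the half-open box with corner [a]. It is defined everywhere and is
    the chart coordinate when it lies in the open box. *)
Definition box_rep n (a x : 'rV[R]_n) : 'rV[R]_n :=
  \row_i (if (i < 2)%N then x 0 i - (Num.floor (x 0 i - a 0 i))%:~R else x 0 i).

Lemma box_rep_period n (a x v : 'rV[R]_n) : period v -> box_rep a (x + v) = box_rep a x.
Proof.
move=> /periodP pv; apply/rowP => i; rewrite !mxE; have := pv i; case: ifP => _.
  move=> vi; rewrite [x 0 i + v 0 i - a 0 i]addrAC floorDrz// intrD (floorK vi).
  by rewrite opprD addrACA subrr addr0.
by move=> ->; rewrite addr0.
Qed.

Lemma period_box_rep n (a x : 'rV[R]_n) : period (box_rep a x - x).
Proof.
apply/periodP => i; rewrite !mxE; case: (i < 2)%N; last by rewrite subrr.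
by rewrite addrAC subrr add0r rpredN intr_int.
Qed.

Lemma box_rep_id n (a x : 'rV[R]_n) : box a x -> box_rep a x = x.
Proof.
move=> bx; apply/rowP => i; rewrite !mxE; case: ifP => // i2.
have /andP[h1 h2] := bx i i2.
by rewrite (@floor_def _ _ 0) ?subr0// ltW ?subr_gt0//= add0r ltrBlDl.
Qed.

Lemma box_rep_proj n (a x y : 'rV[R]_n) : proj x = proj y -> box_rep a x = box_rep a y.
Proof. by move=> /proj_eqP p; rewrite -[x](subrK y) addrC box_rep_period. Qed.

(** Near such a point, translating by the same period stays in the open box. That [box_rep] is
    locally a translation gives the smoothness of the transition maps and of the embedding. *)
Lemma box_rep_near n (a x : 'rV[R]_n) : box a (box_rep a x) ->
  \forall y \near x, box_rep a y = y + (box_rep a x - x).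
Proof.
move=> bx; have : \forall y \near x, box a (y + (box_rep a x - x)).
  apply: (@translate_continuous n (box_rep a x - x) x).
  by rewrite addrC subrK; apply: open_nbhs_nbhs; split => //; exact: box_open.
apply: filterS => y yb; rewrite -[RHS](box_rep_id yb) box_rep_period//.
exact: period_box_rep.
Qed.

Definition box_dom n (a : 'rV[R]_n) : set (cylinder n) := @proj n @` box a.
Definition box_map n (a : 'rV[R]_n) (p : cylinder n) : 'rV[R]_n := box_rep a (lift_point p).

Lemma box_mapE n (a x : 'rV[R]_n) : box_map a (proj x) = box_rep a x.
Proof. by apply: box_rep_proj; rewrite lift_pointK. Qed.

Lemma box_image n (a : 'rV[R]_n) : box_map a @` box_dom a = box a.
Proof.
apply/seteqP; split=> [_ [_ [x bx <-] <-]|x bx]; first by rewrite box_mapE box_rep_id.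
by exists (proj x); [exists x|rewrite box_mapE box_rep_id].
Qed.

Lemma box_dom_open n (a : 'rV[R]_n) : open (box_dom a).
Proof. by apply: proj_open; exact: box_open. Qed.

Lemma box_image_open n (a : 'rV[R]_n) : open (box_map a @` box_dom a).
Proof. by rewrite box_image; exact: box_open. Qed.

Lemma box_mapK n (a : 'rV[R]_n) p : box_dom a p -> proj (box_map a p) = p.
Proof. by move=> [x bx <-]; rewrite box_mapE box_rep_id. Qed.

Lemma box_map_continuous n (a : 'rV[R]_n) p : box_dom a p -> {for p, continuous (box_map a)}.
Proof.
move=> [x bx <-] O nO; change (nbhs (proj x) (box_map a @^-1` O)).
have {}nO : nbhs x O by move: nO; rewrite box_mapE box_rep_id.
have : nbhs x (O `&` box a).
  by apply: filterI => //; apply: open_nbhs_nbhs; split => //; exact: box_open.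
move=> H; pose B := interior (O `&` box a).
have oB : open B by exact: open_interior.
have PB : open_nbhs (proj x) (@proj n @` B) by split; [exact: proj_open|exists x].
apply: filterS (open_nbhs_nbhs PB) => _ [y /interior_subset [Oy by_] <-] /=.
by rewrite box_mapE box_rep_id.
Qed.

Definition box_chart n (a : 'rV[R]_n) : chart R n (cylinder n) :=
  Chart (@box_dom_open n a) (@box_image_open n a) (@box_mapK n a)
    (@box_map_continuous n a) (fun x _ => @proj_continuous n x).

Lemma box_cover n (x : 'rV[R]_n) : box (x - const_mx 2^-1) x.
Proof.
move=> i _; rewrite !mxE; have h : (2^-1 : R) > 0 by rewrite invr_gt0.
have h' : (2^-1 : R) < 1 by rewrite invf_lt1// ltr1n.
by apply/andP; split; lra.
Qed.

(** [2 * e] is the distance from [d] to the nearest integer; the factor 2 leaves room for two strips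
    of half-width [e]. *)
Lemma separate_int (d : R) : d \isn't a Num.int ->
  exists2 e, 0 < e & forall k, k \is a Num.int -> 2 * e <= `|d - k|.
Proof.
move=> nd; pose f : R := (Num.floor d)%:~R.
have fd : f < d.
  rewrite lt_neqAle floor_le andbT; apply: contraNneq nd => <-; exact: intr_int.
have df : d < f + 1 by have := floorD1_gt d; rewrite intrD.
exists (Num.min (d - f) (f + 1 - d) / 2).
  by rewrite divr_gt0// lt_min !subr_gt0 fd.
move=> k /intrP[m ->]; rewrite mulrC divfK ?pnatr_eq0//.
have [mf|mf] := leP m (Num.floor d).
  have : (m%:~R : R) <= f by rewrite ler_int.
  move=> mf'; rewrite ge_min ger0_norm; last by rewrite subr_ge0 (le_trans mf' (ltW fd)).
  by apply/orP; left; lra.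
have : f + 1 <= (m%:~R : R) by rewrite /f -[1]/(1%:~R) -intrD ler_int lezD1.
move=> mf'; rewrite ge_min ler0_norm; last by rewrite subr_le0 (le_trans (ltW df) mf').
by apply/orP; right; lra.
Qed.

(** Some coordinate of [x - y] is obstructed from being that of a period. Strips of half-width [e]
    in that coordinate around [x] and [y] have disjoint images. *)
Lemma cylinder_hausdorff n : hausdorff_space (cylinder n).
Proof.
rewrite open_hausdorff => p q; rewrite -(lift_pointK p) -(lift_pointK q).
set x := lift_point p; set y := lift_point q => pq.
have /forallPn [i hi] : ~~ period (x - y) by apply: contraNN pq => /proj_eqP ->.
have [e e0 he] : exists2 e, 0 < e & forall v : 'rV[R]_n, period v ->
    2 * e <= `|(x - y - v) 0 i|.
  case: ifP hi => i2 hi.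
    have [e e0 he] := separate_int hi; exists e => // v /periodP/(_ i); rewrite i2 => vi.
    by have := he _ vi; rewrite !mxE.
  exists (`|(x - y) 0 i| / 2); first by rewrite divr_gt0// normr_gt0.
  move=> v /periodP/(_ i); rewrite i2 => vi.
  by rewrite mulrC divfK ?pnatr_eq0// [(_ - v) 0 i]mxE [(- v) 0 i]mxE vi subr0.
pose B (z : 'rV[R]_n) := [set u : 'rV[R]_n | z 0 i - e < u 0 i < z 0 i + e].
have oB z : open (B z).
  have := @open_coords n (pred1 i) (fun j => z 0 j - e) (fun j => z 0 j + e).
  congr open; apply/seteqP; split=> u /= H; first exact: H.
  by move=> j /eqP ->.
have Bz z : B z z by rewrite /B/= ltrBlDr ltrDl e0.
exists (@proj n @` B x, @proj n @` B y) => /=.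
  by split; apply/mem_set; [exists x|exists y].
split; [exact: proj_open|exact: proj_open|].
apply/eqP; rewrite -subset0 => _ [[u ux <-] [w wy uw]].
have := he (u - w) (introT (proj_eqP _ _) (esym uw)).
move: ux wy; rewrite /B /= !mxE => /andP[h1 h2] /andP[h3 h4].
by rewrite leNgt => /negP; apply; rewrite ltr_norml; apply/andP; split; lra.
Qed.

Lemma rat_between (a b : R) : a < b -> exists q : rat, a < ratr q < b.
Proof. by move=> ab; have [q] := rat_in_itvoo ab; rewrite in_itv/=; exists q. Qed.

(** Since [proj] is open and continuous, the images of the boxes with rational bounds form a
    base. *)
Lemma cylinder_second_countable n : @second_countable (cylinder n).
Proof.
pose B (qq : {ffun 'I_n -> rat * rat}) : set 'rV[R]_n :=
  [set u | forall i, ratr (qq i).1 < u 0 i < ratr (qq i).2].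
have oB qq : open (B qq).
  have := @open_coords n xpredT (fun j => ratr (qq j).1) (fun j => ratr (qq j).2).
  by congr open; apply/seteqP; split=> u /= H j; [exact: H|move=> _; exact: H].
exists [set @proj n @` B qq | qq in [set: {ffun 'I_n -> rat * rat}]].
  exact: sub_countable (card_image_le _ _) (countableP _).
split=> [_ [qq _ <-]|p A nA]; first exact: proj_open.
rewrite -(lift_pointK p) in nA *; set x := lift_point p in nA *.
have : nbhs x (@proj n @^-1` A) by exact: (@proj_continuous n x).
move=> /nbhs_ballP[e /= e0 he].
have H (i : 'I_n) : exists q : rat * rat, x 0 i - e < ratr q.1 < x 0 i /\ x 0 i < ratr q.2 < x 0 i + e.
  have [q1 h1] := @rat_between (x 0 i - e) (x 0 i) ltac:(by rewrite ltrBlDr ltrDl).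
  have [q2 h2] := @rat_between (x 0 i) (x 0 i + e) ltac:(by rewrite ltrDl).
  by exists (q1, q2).
pose qq : {ffun 'I_n -> rat * rat} := [ffun i => projT1 (cid (H i))].
have Hq i : x 0 i - e < ratr (qq i).1 < x 0 i /\ x 0 i < ratr (qq i).2 < x 0 i + e.
  by rewrite ffunE; exact: projT2 (cid (H i)).
exists (@proj n @` B qq).
  split; first by exists qq.
  by exists x => // i; have [/andP[_ ->] /andP[->]] := Hq i.
move=> _ [u bu <-]; apply: he; split => // j i; rewrite (ord1 j).
have [/andP[h1 _] /andP[_ h2]] := Hq i; have /andP[h3 h4] := bu i.
by rewrite /ball/= ltr_norml; apply/andP; split; lra.
Qed.

End cylinders.

(** * The torus embedded in its product with a line *)

Section cylinder_manifolds.
Variable R : realType.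

(** The linear map covers two cases: the identity for transition maps, and the inclusion of the
    plane for the embedding. *)
Lemma box_rep_affine m n (w : 'I_m -> 'rV[R]_n) b (x : 'rV[R]_m) :
  box b (box_rep b (row_lin w x)) ->
  exists d, \forall y \near x, box_rep b (row_lin w y) = row_lin w y + d.
Proof.
move=> bx; exists (box_rep b (row_lin w x) - row_lin w x).
exact: (@row_lin_continuous R m 'rV[R]_n w x _ (box_rep_near bx)).
Qed.

Lemma box_repK n (b x : 'rV[R]_n) : proj (box_rep b x) = proj x.
Proof. by apply/proj_eqP; exact: period_box_rep. Qed.

Lemma box_domP n (b x : 'rV[R]_n) : box_dom b (proj x) <-> box b (box_rep b x).
Proof.
split=> [[z bz zx]|bx]; last by exists (box_rep b x) => //; exact: box_repK.
by rewrite -(box_rep_proj b zx) box_rep_id.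
Qed.

Lemma overlap_box n (a b : 'rV[R]_n) :
  overlap (box_chart a) (box_chart b) = box a `&` [set x | box b (box_rep b x)].
Proof.
apply/seteqP; split=> [_ [_ [[x bx <-] bp] <-]|x [ax bx]].
  by rewrite /= box_mapE box_rep_id//; split => //; exact/box_domP.
exists (proj x); last by rewrite /= box_mapE box_rep_id.
by split; [exists x|apply/box_domP].
Qed.

Lemma transition_box n (a b x : 'rV[R]_n) :
  transition (box_chart a) (box_chart b) x = box_rep b x.
Proof. exact: box_mapE. Qed.

Lemma transition_affine n (a b x : 'rV[R]_n) : overlap (box_chart a) (box_chart b) x ->
  exists d, \forall y \near x, transition (box_chart a) (box_chart b) y =
    row_lin (fun i => delta_mx 0 i : 'rV[R]_n) y + d.
Proof.
rewrite overlap_box => -[_ bx].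
have [d dE] := @box_rep_affine n n (fun i => delta_mx 0 i) b x
  (eq_ind_r (fun z => box b (box_rep b z)) bx (row_lin_id x)).
exists d; apply: filterS dE => y <-.
by rewrite transition_box row_lin_id.
Qed.

Lemma box_atlas n : smooth_atlas (range (@box_chart R n)).
Proof.
split=> [p|_ _ [a _ <-] [b _ <-]].
  exists (box_chart (lift_point p - const_mx 2^-1)); first by exists (lift_point p - const_mx 2^-1).
  by exists (lift_point p); [exact: box_cover|exact: lift_pointK].
by apply: smooth_affine (@transition_affine n a b); exact: overlap_open.
Qed.

Definition cylinder_manifold n : manifold R n :=
  Manifold (@cylinder_hausdorff R n) (@cylinder_second_countable R n) (box_atlas n).

Lemma jac_transition n (a b x : 'rV[R]_n) : overlap (box_chart a) (box_chart b) x ->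
  jac (transition (box_chart a) (box_chart b)) x = 1%:M.
Proof.
move=> /transition_affine[d dE]; apply/matrixP => i j; rewrite mxE.
by have [_ ->] := pderiv_affine i dE; rewrite !mxE eqxx eq_sym.
Qed.

Lemma cylinder_orientable n : orientable (cylinder_manifold n).
Proof.
exists (range (@box_chart R n)); split; [exact: box_atlas|rewrite setUid; exact: box_atlas|].
by move=> _ _ [a _ <-] [b _ <-] x /jac_transition ->; rewrite det1.
Qed.

(** The closed unit square is compact and maps onto the torus. *)
Lemma torus_compact : compact [set: cylinder_manifold 2].
Proof.
have -> : [set: cylinder_manifold 2] = @proj R 2 @` [set x : 'rV[R]_2 | forall i, `[0, 1]%classic (x 0 i)].
  apply/seteqP; split=> // p _.
  exists (box_rep 0 (lift_point p)); last by rewrite box_repK lift_pointK.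
  move=> i; rewrite /= in_itv/= !mxE ltn_ord subr0.
  set z := lift_point p 0 i; have /andP[h1 h2] := floor_itv z.
  by rewrite subr_ge0 h1 lerBlDr -[1]/(1%:~R) addrC -intrD ltW.
apply: continuous_compact; first exact/continuous_subspaceT/proj_continuous.
by apply: (@rV_compact R 2 (fun=> `[0, 1]%classic)) => _; exact: segment_compact.
Qed.

Lemma box_rep_last (b x : 'rV[R]_3) : box_rep b x 0 ord_max = x 0 ord_max.
Proof. by rewrite mxE. Qed.

Lemma slab_riemannian s : riemannian (fun _ : chart R 3 (cylinder_manifold 3) => slab_metric s).
Proof.
split=> [c i j _|c x i j _ _|c x v _ _ v0|_ _ x [a _ <-] [b _ <-] ov].
- move=> k; have oU := @cimage_open _ _ _ c.
  have H : Ck_on k (cmap c @` cdom c) (fun x : 'rV[R]_3 => expR (2 * (s * x 0 ord_max)) * (i == j)%:R).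
    apply: Ck_onM => //; last exact: Ck_on_cst.
    apply: Ck_on_expR => //; apply: Ck_onM => //; first exact: Ck_on_cst.
    by apply: Ck_onM => //; [exact: Ck_on_cst|exact: smooth_coord].
  by apply: Ck_on_ext oU _ H => y _; rewrite /slab_metric !mxE.
- by rewrite /slab_metric !mxE eq_sym.
- rewrite /slab_metric inner_scale mulr_gt0 ?expR_gt0// inner1 lt_neqAle sumr_ge0 ?andbT; last first.
    by move=> i _; rewrite -expr2 sqr_ge0.
  apply: contra v0 => /eqP/esym/eqP; rewrite psumr_eq0; last by move=> i _; rewrite -expr2 sqr_ge0.
  move=> /allP H; apply/eqP/rowP => i; rewrite mxE; apply/eqP.
  by have := H i (mem_index_enum i); rewrite mulf_eq0 orbb.
(* Transition maps have identity differential and preserve z, the only coordinate on which the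
   metric depends. *)
- rewrite pullbackE jac_transition// mul1mx trmx1 mulmx1 transition_box.
  by rewrite /slab_metric box_rep_last.
Qed.

Lemma widen_ord_eq (i j : 'I_2) :
  (widen_ord (isT : 2 <= 3)%N i == widen_ord (isT : 2 <= 3)%N j) = (i == j).
Proof. by []. Qed.

Definition embed (x : 'rV[R]_2) : 'rV[R]_3 := row_lin (@tangent_basis R) x.

Lemma embed_coord x (i : 'I_2) : embed x 0 (widen_ord (isT : 2 <= 3)%N i) = x 0 i.
Proof.
rewrite /embed /= summxE (bigD1 i)//= !mxE !eqxx mulr1 big1 ?addr0// => j ji.
by rewrite !mxE eqxx /= widen_ord_eq eq_sym (negbTE ji) mulr0.
Qed.

Lemma embed_last x : embed x 0 ord_max = 0.
Proof.
rewrite /embed /= summxE big1// => j _.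
by rewrite !mxE eqxx /= eq_sym widen_neq_max mulr0.
Qed.

Lemma embedP (x : 'rV[R]_2) (P : 'I_3 -> R -> Prop) :
  (forall i : 'I_2, P (widen_ord (isT : 2 <= 3)%N i) (x 0 i)) -> P ord_max 0 ->
  forall i, P i (embed x 0 i).
Proof.
move=> P2 Pm i; have [i2|i2] := boolP (i < 2)%N.
  rewrite (_ : i = widen_ord (isT : 2 <= 3)%N (Ordinal i2)); last exact: val_inj.
  by rewrite embed_coord.
have -> : i = ord_max by apply: val_inj => /=; case: i i2 => [[|[|[|]]]].
by rewrite embed_last.
Qed.

Lemma embed_period x : period x -> period (embed x).
Proof.
move=> /periodP px; by apply/periodP; apply: (embedP (P := fun i r =>
  if (i < 2)%N then (r \is a Num.int : Prop) else r = 0)).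
Qed.

Definition slab_embedding (p : cylinder_manifold 2) : cylinder_manifold 3 :=
  proj (embed (lift_point p)).

(** [embed] is linear and maps periods to periods, so the choice of lift is immaterial. *)
Lemma slab_embeddingE x : slab_embedding (proj x) = proj (embed x).
Proof.
apply/proj_eqP; rewrite /embed -linearB; apply: embed_period.
by rewrite -opprB periodN// lift_proj.
Qed.

Lemma slab_embedding_continuous : continuous slab_embedding.
Proof.
apply/(@quotient_continuous _ {eq_quot @congruent R 2}%qT) => x.
change (continuous_at x (slab_embedding \o @proj R 2)).
rewrite (_ : slab_embedding \o @proj R 2 = @proj R 3 \o embed); last by apply/funext => z; exact: slab_embeddingE.
apply: continuous_comp; first exact: row_lin_continuous.
exact: proj_continuous.
Qed.

Lemma slab_local_rep a b x :
  local_rep slab_embedding (box_chart a) (box_chart b) x = box_rep b (embed x).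
Proof. by rewrite /local_rep /= slab_embeddingE box_mapE. Qed.

Definition slab_domain (a : 'rV[R]_2) (b : 'rV[R]_3) : set 'rV[R]_2 :=
  cmap (box_chart a) @` (cdom (box_chart a) `&` slab_embedding @^-1` cdom (box_chart b)).

Lemma slab_domainE a b : slab_domain a b = box a `&` [set x | box b (box_rep b (embed x))].
Proof.
apply/seteqP; split=> [_ [_ [[x bx <-] bp] <-]|x [ax bx]].
  rewrite /= box_mapE box_rep_id//; split => //; apply/box_domP.
  by move: bp; rewrite /preimage /= slab_embeddingE.
exists (proj x); last by rewrite /= box_mapE box_rep_id.
by split; [exists x|rewrite /preimage /= slab_embeddingE; apply/box_domP].
Qed.

Lemma slab_domain_open a b : open (slab_domain a b).
Proof. by apply: (@immersion_domain_open R 2 3 (cylinder_manifold 2) (cylinder_manifold 3)); exact: slab_embedding_continuous. Qed.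

Lemma slab_local_rep_affine a b x : slab_domain a b x ->
  exists d, \forall y \near x, local_rep slab_embedding (box_chart a) (box_chart b) y =
    row_lin (@tangent_basis R) y + d.
Proof.
rewrite slab_domainE => -[_ /box_rep_affine[d dE]]; exists d.
by apply: filterS dE => y <-; exact: slab_local_rep.
Qed.

Lemma slab_local_rep_pderiv a b x i : slab_domain a b x ->
  pderiv i (local_rep slab_embedding (box_chart a) (box_chart b)) x = tangent_basis R i.
Proof. by move=> /slab_local_rep_affine[d dE]; have [_ ->] := pderiv_affine i dE. Qed.

Lemma slab_immersion : immersion slab_embedding.
Proof.
split; first exact: slab_embedding_continuous.
move=> _ _ [a _ <-] [b _ <-] U; split.
  by apply: smooth_affine (@slab_local_rep_affine a b); exact: slab_domain_open.
move=> x Ux; apply: inj_row_free => v vJ; apply/rowP => i; rewrite mxE.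
have /rowP/(_ (widen_ord (isT : 2 <= 3)%N i)) := vJ.
rewrite !mxE (bigD1 i)//= mxE slab_local_rep_pderiv// mxE !eqxx mulr1 big1 ?addr0// => j ji.
by rewrite mxE slab_local_rep_pderiv// mxE eqxx /= widen_ord_eq eq_sym (negbTE ji) mulr0.
Qed.

Definition height (p : cylinder_manifold 3) : R := lift_point p 0 ord_max.

(** Periods have last coordinate 0, so z descends to the quotient. *)
Lemma heightE (x : 'rV[R]_3) : height (proj x) = x 0 ord_max.
Proof.
have /periodP/(_ ord_max) /= := lift_proj x.
by rewrite !mxE => /eqP; rewrite subr_eq0 => /eqP.
Qed.

Lemma height_smooth : smooth_function height.
Proof.
move=> _ [a _ <-] k; have oU := @cimage_open _ _ _ (box_chart a).
apply: Ck_on_ext oU _ (smooth_coord ord_max oU k) => y _.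
exact/esym/heightE.
Qed.

Lemma conformal_slab (b : 'rV[R]_3) :
  conformal height (fun _ => slab_metric 0) (box_chart b) = slab_metric 1.
Proof.
apply/funext => x; rewrite /conformal /= heightE /slab_metric.
by rewrite mul0r mulr0 expR0 scale1r mul1r.
Qed.

(** [conformal_slab] identifies the two metrics in the charts of the atlas only, hence the
    conditions are transferred one by one. *)
Lemma conformal_slab_riemannian : riemannian (conformal height (fun _ => slab_metric 0)).
Proof.
have [h1 h2 h3 h4] := slab_riemannian 1; split.
- by move=> c i j [b _ <-]; rewrite conformal_slab; apply: (h1 (box_chart b)); exists b.
- move=> c x i j [b _ <-] Ux; rewrite conformal_slab.
  by apply: (h2 (box_chart b)) Ux; exists b.
- move=> c x v [b _ <-] Ux; rewrite conformal_slab.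
  by apply: (h3 (box_chart b)) Ux; exists b.
- move=> c c' x [a _ <-] [b _ <-] Ux; rewrite !conformal_slab.
  by apply: (h4 (box_chart a) (box_chart b)) Ux; [exists a|exists b].
Qed.
End cylinder_manifolds.

(** * Integration over the torus *)

Section slab_integral.
Variable R : realType.

Lemma embed_box (a x : 'rV[R]_2) : box a x -> box (embed a) (embed x).
Proof.
move=> bx i i2; rewrite (_ : i = widen_ord (isT : 2 <= 3)%N (Ordinal i2)); last exact: val_inj.
by rewrite !embed_coord; exact: bx.
Qed.

Lemma slab_domain_embed (a : 'rV[R]_2) : slab_domain a (embed a) = box a.
Proof.
rewrite slab_domainE; apply/seteqP; split=> [x []//|x bx]; split => //=.
by rewrite box_rep_id; exact: embed_box.
Qed.

Lemma slab_scalar_value (P : geometric_scalar R) k1 k2 k3 (s : R)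
    (G : metric (cylinder_manifold R 3)) a b x :
  surface_form P k1 k2 k3 -> riemannian G -> G (box_chart b) = slab_metric s ->
  slab_domain a b x ->
  scalar_value P (G (box_chart b)) (local_rep (@slab_embedding R) (box_chart a) (box_chart b)) x
    = k3 * s ^+ 2 /\
  \det (pullback (G (box_chart b)) (local_rep (@slab_embedding R) (box_chart a) (box_chart b)) x) = 1.
Proof.
move=> PE rG Gb Dx.
have F2 y : slab_domain a b y ->
    local_rep (@slab_embedding R) (box_chart a) (box_chart b) y 0 ord_max = 0.
  by move=> _; rewrite slab_local_rep box_rep_last embed_last.
have F1 y i : slab_domain a b y ->
    pderiv i (local_rep (@slab_embedding R) (box_chart a) (box_chart b)) y = tangent_basis R i.
  by move=> Dy; exact: slab_local_rep_pderiv.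
have oD := @slab_domain_open R a b.
split; last by rewrite Gb (slab_pullback s F2 F1 Dx) det1.
have [p [ap bp] px] := Dx.
have cp : @chart_pair R (cylinder_manifold R 2) (cylinder_manifold R 3) (@slab_embedding R) p
    (box_chart a) (box_chart b).
  by split => //; [exists a|exists b].
have := PE _ _ G _ rG (@slab_immersion R) p _ _ cp; rewrite px => ->.
rewrite Gb (slab_gauss_curvature s oD F2 F1 Dx) (slab_traceless_h_sqnorm s oD F2 F1 Dx).
by rewrite (slab_mean_curvature s oD F2 F1 Dx) !mulr0 !add0r sqrrN.
Qed.

(* The four unit squares with these corners cover the torus: along each axis a
   point is off the boundary of the square starting at 0 or at 1/2. *)
Definition corner (k : 'I_4) : 'rV[R]_2 :=
  \row_i (if (if i == ord0 then odd k else (2 <= k)%N) then 2^-1 else 0).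

Definition slab_cover (k : 'I_4) :
    chart R 2 (cylinder_manifold R 2) * chart R 3 (cylinder_manifold R 3) :=
  (box_chart (corner k), box_chart (embed (corner k))).

Lemma half_nint : (2^-1 : R) \isn't a Num.int.
Proof.
apply/negP => /norm_intr_ge1; rewrite invr_neq0 ?pnatr_eq0// => /(_ isT).
by rewrite ger0_norm ?invr_ge0// leNgt invf_lt1// ltr1n.
Qed.

Lemma box_rep_box n (a x : 'rV[R]_n) :
  (forall i : 'I_n, (i < 2)%N -> x 0 i - a 0 i \isn't a Num.int) -> box a (box_rep a x).
Proof.
move=> H i i2; rewrite mxE i2; have {H}ni := H i i2.
have /andP[h1 h2] := floor_itv (x 0 i - a 0 i); rewrite intrD in h2.
have h3 : (Num.floor (x 0 i - a 0 i))%:~R < x 0 i - a 0 i.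
  by rewrite lt_neqAle h1 andbT; apply: contraNneq ni => <-; exact: intr_int.
by apply/andP; split; lra.
Qed.

Lemma slab_patch (a x : 'rV[R]_2) : box a (box_rep a x) ->
  @chart_patch R (cylinder_manifold R 2) (cylinder_manifold R 3) (@slab_embedding R)
    (box_chart a, box_chart (embed a)) (proj x).
Proof.
move=> bx; split; first by apply/box_domP.
rewrite -(box_repK a x) /preimage /= slab_embeddingE.
by exists (embed (box_rep a x)) => //; exact: embed_box.
Qed.

Lemma slab_coverP :
  @patch_cover R (cylinder_manifold R 2) (cylinder_manifold R 3) (@slab_embedding R) 4 slab_cover.
Proof.
split=> [k|p]; first by split; [exists (corner k)|exists (embed (corner k))].
rewrite -(lift_pointK p); set x := lift_point p.
pose b0 := x 0 ord0 \is a Num.int; pose b1 := x 0 ord_max \is a Num.int.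
(* The bits of the index choose the corner: 1/2 along an axis where the coordinate is an integer, 0
   elsewhere. The point then avoids the boundary in both directions. *)
have kb : (b0 + 2 * b1 < 4)%N by case: b0; case: b1.
exists (Ordinal kb); apply: slab_patch; apply: box_rep_box => i _.
have half (r : R) : r - (if r \is a Num.int then 2^-1 else 0) \isn't a Num.int.
  case: (boolP (r \is a Num.int)) => ri; last by rewrite subr0.
  apply: contra half_nint => ri'; rewrite -[2^-1](opprK) -[- 2^-1](addKr r) rpredN.
  by rewrite rpredD// rpredN.
rewrite mxE /=; case: (ord2P i) => ->; rewrite /=.
  have H (u v : bool) : odd (u + 2 * v) = u by case: u; case: v.
  by rewrite H; exact: half.
have H (u v : bool) : (2 <= u + 2 * v)%N = v by case: u; case: v.
by rewrite H; exact: half.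
Qed.

Definition plane_measure := (@lebesgue_measure R \x @lebesgue_measure R)%E.

Definition slab_piece (i : 'I_4) : set (R * R) :=
  [set z | (cmap (slab_cover i).1 @`
     (chart_patch (@slab_embedding R) (slab_cover i) `\`
      \bigcup_(j in [set j : 'I_4 | (j < i)%N]) chart_patch (@slab_embedding R) (slab_cover j)))
     (plane_point z)].

Lemma slab_surface_integral (P : geometric_scalar R) k1 k2 k3 (s : R)
    (G : metric (cylinder_manifold R 3)) :
  surface_form P k1 k2 k3 -> riemannian G -> (forall b, G (box_chart b) = slab_metric s) ->
  surface_integral (@slab_embedding R) slab_cover G P =
  \sum_(i < 4) \int[plane_measure]_(z in slab_piece i) (k3 * s ^+ 2).
Proof.
move=> PE rG Gb; rewrite /surface_integral; apply: eq_bigr => i _.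
apply: eq_Rintegral => z /set_mem [p [[ap fp] _] pz].
have Dz : slab_domain (corner i) (embed (corner i)) (plane_point z) by exists p.
have [-> ->] := slab_scalar_value PE rG (Gb _) Dz.
by rewrite sqrtr1 mulr1.
Qed.

(** No earlier patch is removed from the first one, and the ambient chart at the same corner
    contains the whole image of the box. *)
Lemma slab_piece0 : slab_piece ord0 = `]0, 1[%classic `*` `]0, 1[%classic.
Proof.
have c0 : corner ord0 = 0 by apply/rowP => i; rewrite !mxE /=; case: (i == ord0).
have E : slab_piece ord0 = [set z | box (corner ord0) (plane_point z)].
  rewrite -slab_domain_embed; apply/seteqP; split=> z [p [pp]].
    by move=> _ pz; exists p.
  move=> fp pz; exists p => //; split; first by split.
  by move=> [].
rewrite E c0; apply/seteqP; split=> [z bz|z [z1 z2] i _].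
  have := bz ord0 isT; have := bz ord_max isT; rewrite !mxE /= add0r => h2 h1.
  by split; rewrite /= in_itv.
rewrite !mxE add0r; case: (ord2P i) => -> /=.
  by move: z1; rewrite /= in_itv.
by move: z2; rewrite /= in_itv.
Qed.

Lemma slab_piece0_measure : plane_measure (slab_piece ord0) = 1%E.
Proof.
rewrite slab_piece0 /plane_measure product_measure1E//.
have l01 : @lebesgue_measure R `]0, 1[%classic = 1%E.
  by rewrite lebesgue_measure_itv/= lte_fin ltr01 oppr0 adde0.
exact: etrans (congr2 mule l01 l01) (mule1 _).
Qed.

(* [D] need not be measurable, so that only the first piece of the torus has to
   be computed. *)
Lemma cst_Rintegral_sign (D : set (R * R)) (r : R) :
  0 <= r * \int[plane_measure]_(z in D) r.
Proof.
have [r0|r0] := leP 0 r; first by rewrite mulr_ge0// Rintegral_ge0.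
have -> : \int[plane_measure]_(z in D) r = - \int[plane_measure]_(z in D) (- r).
  rewrite /Rintegral -fineN; congr fine.
  rewrite -integral_ge0N; last by move=> z _; rewrite lee_fin oppr_ge0 ltW.
  by apply: eq_integral => z _; rewrite /= opprK.
by rewrite mulrN -mulNr mulr_ge0 ?oppr_ge0 ?(ltW r0)// Rintegral_ge0// => z _; rewrite oppr_ge0 ltW.
Qed.

(** With slab parameter s the integrand is the constant [k3 * s ^+ 2], so invariance equates the
    integrals of [k3] and of 0. *)
Lemma conformal_invariant_mean_coef (P : geometric_scalar R) k1 k2 k3 :
  global_conformal_invariant P -> surface_form P k1 k2 k3 -> k3 = 0.
Proof.
move=> [_ inv] PE.
have := inv (cylinder_manifold R 2) (cylinder_manifold R 3) (fun _ => slab_metric 0)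
  (@slab_embedding R) (@height R) (@torus_compact R) (@cylinder_orientable R 2)
  (@slab_riemannian R 0) (@slab_immersion R) (@height_smooth R) 4 slab_cover slab_coverP.
rewrite (slab_surface_integral PE (@conformal_slab_riemannian R) (@conformal_slab R)).
rewrite (slab_surface_integral (s := 0) PE (@slab_riemannian R 0))//.
rewrite expr1n mulr1 expr0n /= mulr0 [RHS]big1 => [e|i _]; last first.
  by rewrite /Rintegral integral0.
(* Multiplied by [k3], all four terms become nonnegative, so each of them is 0; the first one is
   [k3 * k3], its piece having measure 1. *)
have e' : \sum_(i < 4) k3 * \int[plane_measure]_(z in slab_piece i) k3 = 0.
  by rewrite -mulr_sumr e mulr0.
move/eqP: e'; rewrite psumr_eq0; last by move=> i _; exact: cst_Rintegral_sign.
move=> /allP /(_ ord0 (mem_index_enum _)) /=.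
rewrite Rintegral_cst; last by rewrite slab_piece0; exact: measurableX.
set m := fine _; have -> : m = 1 by exact: (congr1 fine slab_piece0_measure).
by rewrite mulr1 mulf_eq0 orbb => /eqP.
Qed.
End slab_integral.


Theorem theorem3p1 (R : realType) (P : geometric_scalar R)
    (hP : global_conformal_invariant P) :
  exists a b : R,
    forall (M : manifold R 2) (N : manifold R 3) (G : metric N) (f : M -> N),
      riemannian G -> immersion f ->
      forall (p : M) (c : chart R 2 M) (c' : chart R 3 N),
        chart_pair f p c c' ->
        scalar_value P (G c') (local_rep f c c') (cmap c p)
        = a * gauss_curvature (pullback (G c') (local_rep f c c')) (cmap c p)
          + b * traceless_h_sqnorm (G c') (local_rep f c c') (cmap c p).
Proof.
have [a [b [c PE]]] := scalar_surface_form hP.1.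
have c0 := conformal_invariant_mean_coef hP PE; subst c.
exists a, b => M N G f rG fi p ch ch' chp.
by rewrite (PE M N G f rG fi p ch ch' chp) mul0r addr0.
Qed.
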